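(* Let $n,m\in\mathbb{N}$ and let $(X,Y)\sim\theta\in M_1^{1,1}(\mathbb{R}^n\times\mathbb{R}^m)$ have marginals $X\sim\mu\in M_1^1(\mathbb{R}^n)$ and $Y\sim\nu\in M_1^1(\mathbb{R}^m)$, where $\mathbb{R}^n$ and $\mathbb{R}^m$ carry their Euclidean metrics. Then $$\sqrt{dcov(X,Y)}=\sqrt{\frac{1}{c_nc_m}\int_{\mathbb{R}^n\times\mathbb{R}^m}\frac{|\hat\theta(t,s)-\hat\mu(t)\hat\nu(s)|^2}{\|t\|_{\mathbb{R}^n}^{n+1}\|s\|_{\mathbb{R}^m}^{m+1}}\,d(\lambda^n\times\lambda^m)(t,s)} ,$$ that is, the square root of the distance covariance measure in metric spaces coincides with the Euclidean distance covariance given by the right-hand side. Here $\hat\theta:\mathbb{R}^{n+m}\to\mathbb{C}$, $\hat\mu:\mathbb{R}^n\to\mathbb{C}$ and $\hat\nu:\mathbb{R}^m\to\mathbb{C}$ are the characteristic functions of $\theta$, $\mu$ and $\nu$, $\lambda^k$ is Lebesgue measure on $\mathbb{R}^k$, and $c_k=\pi^{(1+k)/2}/\Gamma((1+k)/2)$ for $k\in\mathbb{N}$.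
   Context: $M_1^1(\mathbb{R}^n)$ is the set of Borel probability measures on $\mathbb{R}^n$ with finite first moment; $M_1^{1,1}(\mathbb{R}^n\times\mathbb{R}^m)$ is the set of Borel probability measures on $\mathbb{R}^n\times\mathbb{R}^m$ whose two marginals have finite first moment. For a metric space $(\mathcal{X},d_{\mathcal{X}})$ and $\mu\in M_1^1(\mathcal{X})$: $a_\mu(x)=\int d_{\mathcal{X}}(x,y)\,d\mu(y)$, $D(\mu)=\int a_\mu\,d\mu$, $d_\mu(x_1,x_2)=d_{\mathcal{X}}(x_1,x_2)-a_\mu(x_1)-a_\mu(x_2)+D(\mu)$. For $(X,Y)\sim\theta$ with marginals $\mu,\nu$, $dcov(X,Y)=dcov(\theta)=\int d_\mu(x_1,x_2)d_\nu(y_1,y_2)\,d(\theta\times\theta)((x_1,y_1),(x_2,y_2))$; it is nonnegative in the present setting. The characteristic function of a Borel probability measure $\rho$ on $\mathbb{R}^k$ is $\hat\rho(t)=\int e^{i\langle t,x\rangle}\,d\rho(x)$. *)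

(* Defs.v *)
From HB Require Import structures.
From mathcomp Require Import all_boot all_order all_algebra.
From mathcomp Require Import all_classical all_reals all_analysis.
From mathcomp Require Export complex.
Set Implicit Arguments.
Unset Strict Implicit.
Unset Printing Implicit Defensive.
Import Order.TTheory GRing.Theory Num.Theory.
Import numFieldNormedType.Exports.

Local Open Scope classical_set_scope.
Local Open Scope ring_scope.

(* R^n is [n.-tuple R] with its measurable structure, the product of the Borel
   sigma-algebras of the coordinates, i.e. the Borel sigma-algebra of R^n;
   likewise for R^n x R^m. *)
Section euclidean.
Context {R : realType} {n : nat}.
Implicit Types x y : n.-tuple R.

Definition euclid_dot x y : R := \sum_(i < n) tnth x i * tnth y i.

Definition euclid_norm x : R := Num.sqrt (euclid_dot x x).

Definition euclid_dist x y : R := euclid_norm [tuple tnth x i - tnth y i | i < n].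

End euclidean.

Section marginals.
Context d1 d2 (T1 : measurableType d1) (T2 : measurableType d2) (R : realType).
Variable theta : probability (T1 * T2)%type R.

HB.instance Definition _ :=
  isMeasurableFun.Build _ _ _ _ (@fst T1 T2) measurable_fst.
HB.instance Definition _ :=
  isMeasurableFun.Build _ _ _ _ (@snd T1 T2) measurable_snd.

Definition marginal1 : probability T1 R := distribution theta (@fst T1 T2).
Definition marginal2 : probability T2 R := distribution theta (@snd T1 T2).

End marginals.

Definition finite_first_moment (R : realType) (n : nat)
    (mu : probability (n.-tuple R) R) : Prop :=
  (\int[mu]_x (euclid_norm x)%:E < +oo)%E.

Section distance_covariance.
Context {R : realType}.

Section centered_distance.
Context d (T : measurableType d) (dist : T -> T -> R) (mu : probability T R).

(* a_mu *)
Definition mean_dist (x : T) : R := \int[mu]_y dist x y.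

(* D(mu) *)
Definition total_mean_dist : R := \int[mu]_x mean_dist x.

(* d_mu *)
Definition centered_dist (x1 x2 : T) : R :=
  dist x1 x2 - mean_dist x1 - mean_dist x2 + total_mean_dist.

End centered_distance.

Definition dcov d1 d2 (T1 : measurableType d1) (T2 : measurableType d2)
    (dist1 : T1 -> T1 -> R) (dist2 : T2 -> T2 -> R)
    (theta : probability (T1 * T2)%type R) : R :=
  \int[(theta \x theta)%E]_p
    (centered_dist dist1 (marginal1 theta) p.1.1 p.2.1 *
     centered_dist dist2 (marginal2 theta) p.1.2 p.2.2).

End distance_covariance.

Section characteristic_function.
Context {R : realType}.
Local Open Scope complex_scope.

(* Componentwise integral of a complex-valued function *)
Definition Cintegral d (T : measurableType d) (mu : probability T R)
    (f : T -> R[i]) : R[i] :=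
  (\int[mu]_x complex.Re (f x)) +i* (\int[mu]_x complex.Im (f x)).

Definition expi (a : R) : R[i] := cos a +i* sin a.

Definition charfun n (rho : probability (n.-tuple R) R) (t : n.-tuple R) :
    R[i] :=
  Cintegral rho (fun x => expi (euclid_dot t x)).

(* Characteristic function on R^(n+m), with R^(n+m) written as R^n x R^m *)
Definition charfun2 n m (rho : probability (n.-tuple R * m.-tuple R)%type R)
    (t : n.-tuple R) (s : m.-tuple R) : R[i] :=
  Cintegral rho (fun p => expi (euclid_dot t p.1 + euclid_dot s p.2)).

End characteristic_function.

Section lebesgue_measure_tuple.
Context {R : realType}.
Local Open Scope ereal_scope.

Definition tuple_cons n (p : measurableTypeR R * n.-tuple R) : n.+1.-tuple R :=
  [the n.+1.-tuple R of p.1 :: p.2].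

Lemma measurable_tuple_cons n : measurable_fun setT (@tuple_cons n).
Proof. exact: measurable_cons. Qed.

Section step.
Context n (mu : {sigma_finite_measure set (n.-tuple R) -> \bar R}).

Definition lebesgue_cons : set (n.+1.-tuple R) -> \bar R :=
  pushforward (@lebesgue_measure R \x mu) (@tuple_cons n).

Let lebesgue_cons0 : lebesgue_cons set0 = 0.
Proof. by rewrite /lebesgue_cons /pushforward preimage_set0 measure0. Qed.

Let lebesgue_cons_ge0 A : 0 <= lebesgue_cons A.
Proof. by rewrite /lebesgue_cons /pushforward; exact: measure_ge0. Qed.

Let lebesgue_cons_sigma_additive : semi_sigma_additive lebesgue_cons.
Proof.
move=> F mF tF mUF; rewrite /lebesgue_cons /pushforward preimage_bigcup.
apply: measure_semi_sigma_additive.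
- by move=> i; rewrite -[X in measurable X]setTI; exact: measurable_tuple_cons.
- apply/trivIsetP => /= i j _ _ ij; rewrite -preimage_setI.
  by move/trivIsetP : tF => /(_ _ _ _ _ ij) ->//; rewrite preimage_set0.
- rewrite -preimage_bigcup -[X in measurable X]setTI.
  exact: measurable_tuple_cons.
Qed.

HB.instance Definition _ := isMeasure.Build _ _ _ lebesgue_cons
  lebesgue_cons0 lebesgue_cons_ge0 lebesgue_cons_sigma_additive.

Let lebesgue_cons_sigma_finite : sigma_finite setT lebesgue_cons.
Proof.
have /sigma_finiteP[F [TF ndF Foo]] := sigma_finiteT (@lebesgue_measure R).
have /sigma_finiteP[G [TG ndG Goo]] := sigma_finiteT mu.
pose split_tuple (x : n.+1.-tuple R) : measurableTypeR R * n.-tuple R :=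
  (thead x, [tuple of behead x]).
have msplit : measurable_fun setT split_tuple.
  by apply/measurable_fun_pair; [exact: measurable_tnth|exact: measurable_behead].
have splitK p : split_tuple (tuple_cons p) = p.
  by case: p => a x; rewrite /split_tuple /=; congr pair; apply: val_inj.
exists (fun k => split_tuple @^-1` (F k `*` G k)).
  rewrite -preimage_bigcup (_ : \bigcup_k _ = setT) ?preimage_setT//.
  rewrite predeqE => -[x y]; split=> // _.
  have [i _ Fix] : (\bigcup_k F k) x by rewrite -TF.
  have [j _ Gjy] : (\bigcup_k G k) y by rewrite -TG.
  exists (maxn i j) => //; split.
    by move: x Fix; exact/subsetPset/ndF/leq_maxl.
  by move: y Gjy; exact/subsetPset/ndG/leq_maxr.
move=> k; have [mF Fkoo] := Foo k; have [mG Gkoo] := Goo k; split.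
  by rewrite -[X in measurable X]setTI; apply: msplit => //; exact: measurableX.
rewrite /lebesgue_cons /pushforward -comp_preimage.
rewrite (_ : _ \o _ = id); last by apply/funext => p; exact: splitK.
rewrite preimage_id product_measure1E// lte_mul_pinfty// ge0_fin_numE//.
Qed.

HB.instance Definition _ := Measure_isSigmaFinite.Build _ _ _ lebesgue_cons
  lebesgue_cons_sigma_finite.

End step.

(* Lebesgue measure on R^n, as the n-fold product of [lebesgue_measure] *)
Fixpoint lebesgue_tuple n : {sigma_finite_measure set (n.-tuple R) -> \bar R} :=
  match n with
  | 0%N => [the {sigma_finite_measure set (0.-tuple R) -> \bar R} of
              @dirac _ (0.-tuple R) [tuple] R]
  | n'.+1 => [the {sigma_finite_measure set (n'.+1.-tuple R) -> \bar R} of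
              lebesgue_cons (lebesgue_tuple n')]
  end.

Lemma lebesgue_tuple_box n (A : 'I_n -> set (measurableTypeR R)) :
  (forall i, measurable (A i)) ->
  lebesgue_tuple n [set x | forall i, A i (tnth x i)] =
  \prod_(i < n) lebesgue_measure (A i).
Proof.
elim: n A => [|n IHn] A mA /=.
  by rewrite big_ord0 diracE mem_set//= => -[].
rewrite /lebesgue_cons /pushforward big_ord_recl -IHn//.
rewrite -product_measure1E//; last first.
  rewrite (_ : mkset _ =
    \bigcap_(i : 'I_n) ((@tnth n R)^~ i @^-1` A (lift ord0 i))).
    apply: fin_bigcap_measurable => // i _.
    by rewrite -[X in measurable X]setTI; apply: measurable_tnth => //; exact: mA.
  by apply/seteqP; split=> x /= h i => [_|]; exact: h.
congr ((_ \x _) _); apply/seteqP; split=> -[a x] /=.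
  move=> h; split; first by have := h ord0.
  by move=> i; have := h (lift ord0 i); rewrite tnthS.
move=> [ha hx] i; case: (unliftP ord0 i) => [j ->|-> //].
by rewrite tnthS; exact: hx.
Qed.

End lebesgue_measure_tuple.

Definition Gamma {R : realType} (z : R) : R :=
  \int[@lebesgue_measure R]_(t in `]0, +oo[) (t `^ (z - 1) * expR (- t)).

Definition cst_c {R : realType} (k : nat) : R :=
  pi `^ ((1 + k%:R) / 2) / Gamma ((1 + k%:R) / 2).

(* Main.v *)
Require Import Defs.
From HB Require Import structures.
From mathcomp Require Import all_boot all_order all_algebra.
From mathcomp Require Import all_classical all_reals all_analysis.
From mathcomp Require Import measurable_realfun ring lra.
Set Implicit Arguments.
Unset Strict Implicit.
Unset Printing Implicit Defensive.
Import Order.TTheory GRing.Theory Num.Theory.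
Import numFieldNormedType.Exports.

Local Open Scope classical_set_scope.
Local Open Scope ring_scope.

(** Write phi_t(x) = exp (i <t, x>). The proof rests on the representation of
    the Euclidean norm as a superposition of the functions 1 - cos <t, x>,
      int (1 - cos <t, x>) / |t|^(n+1) dt = c_n |x|    ([integral_cosine_kernel]).
    It is obtained by writing |t|^-(n+1), up to the factor Gamma ((n+1)/2), as a
    mixture of Gaussians exp (- |t|^2 / w^2) ([egamma_half_mixture]). Against such a
    Gaussian, 1 - cos <t, x> is integrated explicitly from the Fourier transform of
    the Gaussian ([integral_tuple_cos_gauss]), and the remaining integral over w is
    elementary ([integral_onem_gauss]).

    The difference of characteristic functions at (t, s) is the covariance of
    phi_t(X) and phi_s(Y), that is the mean of the product of the centred functions
    phi_t(X) - E phi_t(X) and phi_s(Y) - E phi_s(Y). Split into real and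
    imaginary parts, its squared modulus is a sum of four squared means plus cross
    terms that are odd in s and disappear in the integral. A squared mean is a
    double mean over two independent copies (X, Y), (X', Y') of the pair, so
    exchanging integrals ([integral_sqr_mean]) gives the mean of K(X, X') K'(Y, Y')
    for kernels K, K' that are integrals over t and over s alone. By the
    representation of the norm, the kernels add up to - c_n and - c_m times the
    doubly centred distances ([kernel_sum]), and the product of these sums is
    c_n c_m times the integrand of the distance covariance
    ([integral_charfun_dist]).

    The constants c_n and c_m can be divided out when n and m are positive. In
    dimension zero every distance vanishes, and so do both sides. *)

(** * Dilations and reflections of the line *)

Section lebesgue_dilation.
Context {R : realType}.
Notation mu := (@lebesgue_measure R).
Local Open Scope ereal_scope.

Lemma lebesgue_measure_scale (a : R) (A : set (measurableTypeR R)) :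
  (0 < a)%R -> measurable A ->
  pushforward mu (( *%R a) : _ -> measurableTypeR R) A = a^-1%:E * mu A.
Proof.
move=> a0 mA; have ai0 : (0 <= a^-1)%R by rewrite invr_ge0 ltW.
have ma : measurable_fun [set: measurableTypeR R]
    (( *%R a) : _ -> measurableTypeR R) by exact: mulrl_measurable.
pose k : {nonneg R} := NngNum (ltW a0).
have H X : measurable X -> mu X =
    mscale k (pushforward mu (( *%R a) : _ -> measurableTypeR R)) X.
  apply: lebesgue_measure_unique => _ [[p q]] _ <-.
  have E : (( *%R a) : R -> R) @^-1` `]p, q]%classic =
      `](a^-1 * p)%R, (a^-1 * q)%R]%classic.
    by apply/seteqP; split => x /=; rewrite !in_itv/= ltr_pdivrMl// ler_pdivlMl.
  change (mu `]p, q]%classic = a%:E * mu ((( *%R a) : R -> R) @^-1` `]p, q]%classic)).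
  rewrite E.
  rewrite !lebesgue_measure_itv/= !lte_fin ltr_pM2l ?invr_gt0//.
  case: ifPn => // _; last by rewrite mule0.
  by rewrite -!EFinD -EFinM -mulrBr mulVKf// gt_eqF.
rewrite H// /mscale/= muleA -EFinM mulVf ?gt_eqF// mul1e//.
Qed.

Lemma ge0_integral_scale (a : R) (f : R -> \bar R) : (0 < a)%R ->
  measurable_fun setT f -> (forall x, 0 <= f x) ->
  \int[mu]_x f (a * x)%R = a^-1%:E * \int[mu]_x f x.
Proof.
move=> a0 mf f0; have ai0 : (0 <= a^-1)%R by rewrite invr_ge0 ltW.
have ma : measurable_fun [set: measurableTypeR R]
    (( *%R a) : _ -> measurableTypeR R) by exact: mulrl_measurable.
rewrite -(@ge0_integral_mscale _ _ R mu setT measurableT (NngNum ai0))//.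
transitivity (\int[pushforward mu (( *%R a) : _ -> measurableTypeR R)]_x f x).
  by rewrite ge0_integral_pushforward.
apply: eq_measure_integral => A mA _.
exact: (lebesgue_measure_scale a0 mA).
Qed.

Lemma ge0_integral_opp (f : R -> \bar R) :
  measurable_fun setT f -> (forall x, 0 <= f x) ->
  \int[mu]_x f (- x)%R = \int[mu]_x f x.
Proof.
move=> mf f0.
transitivity (\int[pushforward mu (-%R : _ -> measurableTypeR R)]_x f x).
  by rewrite ge0_integral_pushforward.
by apply: eq_measure_integral => A mA _; exact: lebesgue_measureN.
Qed.

End lebesgue_dilation.

(** * The Fourier transform of the Gaussian *)

Section gaussian_cosine.
Context {R : realType}.
Notation mu := (@lebesgue_measure R).

(** An integration by parts without boundary terms: the integrals over
    the intervals [-n, n] are G n - G (- n), which tend to 0, and by dominated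
    convergence they tend to the integral of g. *)
Lemma integral_derivative_eq0 (g G : R -> R) :
  continuous g -> mu.-integrable setT (EFin \o g) ->
  (forall x : R, is_derive x 1 G (g x)) ->
  G x @[x --> +oo] --> (0:R) -> G x @[x --> -oo] --> (0:R) ->
  \int[mu]_x g x = 0.
Proof.
move=> cg ig dG Gy GNy.
have mg : measurable_fun setT g by exact: continuous_measurable_fun.
(* truncations of g to the intervals [-n, n] *)
pose f n (x : R) : \bar R := ((EFin \o g) \_ `[- n%:R, n%:R]) x.
have mf n : measurable_fun setT (f n).
  apply/(measurable_restrictT _ _).1 => //.
  by apply/measurable_EFinP; exact: measurable_funTS.
have cvf x : f n x @[n --> \oo] --> (g x)%:E.
  apply: cvg_near_cst; near=> n.
  rewrite /f patchE ifT//= inE/= in_itv/= -ler_norml.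
  by near: n; exact: nbhs_infty_ger.
have acvf : {ae mu, forall x, setT x ->
    f n x @[n --> \oo] --> (EFin \o g) x}.
  by apply: aeW => x _; exact: cvf.
have bf : {ae mu, forall x n, setT x -> (`|f n x| <= `|(g x)%:E|)%E}.
  apply: aeW => x n _; rewrite /f patchE; case: ifPn => //= _.
  by rewrite lee_fin normr0.
have [_ _ H] := @dominated_convergence _ _ _ mu setT measurableT f
  (EFin \o g) (abse \o (EFin \o g)) mf ((measurable_EFinP _ _).2 mg) acvf
  (integrable_abse ig) bf.
have E n : (\int[mu]_x f n.+1 x = (G n.+1%:R - G (- n.+1%:R))%:E)%E.
  rewrite /f -integral_mkcond (@continuous_FTC2 _ g G)//.
  - have n0 : (0:R) < n.+1%:R by rewrite ltr0n.
    by rewrite (lt_trans _ n0)// oppr_lt0.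
  - exact: continuous_subspaceT.
  - have dr x : derivable G x 1 by have [] := dG x.
    have cG x : {for x, continuous G}.
      exact/differentiable_continuous/derivable1_diffP.
    split => //; [exact/cvg_at_right_filter/cG|exact/cvg_at_left_filter/cG].
  - by move=> x _; rewrite derive1E; have [_ ->] := dG x.
have L1 : (\int[mu]_x f n.+1 x)%E @[n --> \oo] --> (\int[mu]_x (g x)%:E)%E.
  by rewrite -(cvg_shiftS) in H.
have L2 : (\int[mu]_x f n.+1 x)%E @[n --> \oo] --> 0%E.
  under eq_fun do rewrite E.
  apply: cvg_EFin; first exact: nearW.
  rewrite /comp/= -[X in _ --> X](subr0 0).
  apply: cvgB.
    apply: (cvg_comp (fun n : nat => n.+1%:R) G _ Gy).
    by apply/cvgryPge => A; near=> n; rewrite (@le_trans _ _ n%:R)// ?ler_nat//;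
      near: n; exact: nbhs_infty_ger.
  apply: (cvg_comp (fun n : nat => - n.+1%:R) G _ GNy).
  apply/cvgrNyPle => A; near=> n.
  rewrite lerNl (@le_trans _ _ n%:R)// ?ler_nat//;
    near: n; exact: nbhs_infty_ger.
rewrite /Rintegral.
by have -> := cvg_unique _ L1 L2.
Unshelve. all: by end_near. Qed.

Lemma integrable_gauss_fun_scale (a : R) : 0 < a ->
  mu.-integrable setT (fun t => (gauss_fun (a * t))%:E).
Proof.
move=> a0; apply/integrableP; split.
  by apply/measurable_EFinP; apply: measurableT_comp;
    [exact: measurable_gauss_fun|exact: mulrl_measurable].
under eq_integral do rewrite gee0_abs ?lee_fin ?gauss_fun_ge0//.
rewrite (@ge0_integral_scale _ a (fun t => (gauss_fun t)%:E))//.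
- by rewrite integralT_gauss -EFinM ltry.
- by apply/measurable_EFinP; exact: measurable_gauss_fun.
- by move=> t; rewrite lee_fin gauss_fun_ge0.
Qed.

(** Since |t| <= 1 + t^2 / 2 <= exp (t^2 / 2), the function is dominated by
    the wider Gaussian exp (- t^2 / 2). It is the dominating function that allows
    differentiation under the integral sign below. *)
Lemma integrable_norm_gauss_fun :
  mu.-integrable setT (fun t => (`|t| * gauss_fun t)%:E).
Proof.
have s2 : 0 < (Num.sqrt 2)^-1 :> R by rewrite invr_gt0 sqrtr_gt0.
apply: (le_integrable _ _ _ (integrable_gauss_fun_scale s2)) => //.
  apply/measurable_EFinP/measurable_funM; first exact: normr_measurable.
  exact: measurable_gauss_fun.
move=> t _; rewrite !abse_EFin lee_fin (ger0_norm (gauss_fun_ge0 _)).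
rewrite ger0_norm ?mulr_ge0 ?gauss_fun_ge0// /gauss_fun exprMn exprVn sqr_sqrtr//.
rewrite [X in _ * X](_ : _ = expR (- (2^-1 * t ^+ 2)) * expR (- (2^-1 * t ^+ 2)));
  last by rewrite -expRD; congr expR; field.
rewrite mulrA ler_piMl ?expR_ge0// expRN ler_pdivrMr ?expR_gt0// mul1r.
apply: le_trans (expR_ge1Dx _).
rewrite -subr_ge0.
rewrite (_ : _ - _ = ((`|t| - 1) ^+ 2 + 1) / 2).
  by rewrite divr_ge0// addr_ge0// sqr_ge0.
by rewrite -real_normK ?num_real//; field.
Qed.

(** The Fourier transform of exp (- t^2), which is real by parity. It is
    computed from its differential equation g'(x) = - (x / 2) g(x). *)
Definition cosine_gauss (x : R) : R := \int[mu]_t (cos (x * t) * gauss_fun t).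

Lemma measurable_cos : measurable_fun setT (@cos R).
Proof. exact: (continuous_measurable_fun (@continuous_cos R)). Qed.

Lemma measurable_sin : measurable_fun setT (@sin R).
Proof. exact: (continuous_measurable_fun (@continuous_sin R)). Qed.

Lemma measurable_cosM (x : R) : measurable_fun setT (fun t : R => cos (x * t)).
Proof. by apply: (measurableT_comp measurable_cos); exact: mulrl_measurable. Qed.

Lemma measurable_sinM (x : R) : measurable_fun setT (fun t : R => sin (x * t)).
Proof. by apply: (measurableT_comp measurable_sin); exact: mulrl_measurable. Qed.

Lemma integrable_cosine_gauss (x : R) :
  mu.-integrable setT (fun t => (cos (x * t) * gauss_fun t)%:E).
Proof.
apply: (le_integrable _ _ _ integrableT_gauss) => //.
  apply/measurable_EFinP/measurable_funM; first exact: measurable_cosM.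
  exact: measurable_gauss_fun.
move=> t _; rewrite !abse_EFin lee_fin normrM ler_piMl//.
by rewrite ler_norml cos_geN1 cos_le1.
Qed.

Lemma integrable_sine_gauss (x : R) :
  mu.-integrable setT (fun t => (t * sin (x * t) * gauss_fun t)%:E).
Proof.
apply: (le_integrable _ _ _ integrable_norm_gauss_fun) => //.
  apply/measurable_EFinP/measurable_funM; last exact: measurable_gauss_fun.
  by apply: measurable_funM => //; exact: measurable_sinM.
move=> t _; rewrite !abse_EFin lee_fin !normrM normr_id ler_wpM2r//.
by rewrite ler_piMr// ler_norml sin_geN1 sin_le1.
Qed.

Let dpartial (x t : R) :
  is_derive x 1 (fun x => cos (x * t) * gauss_fun t) (- (t * sin (x * t) * gauss_fun t)).
Proof.
apply: is_derive_eq.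
rewrite /GRing.scale/=. ring.
Qed.

Lemma is_derive_cosine_gauss (x : R) :
  is_derive x 1 cosine_gauss (- \int[mu]_t (t * sin (x * t) * gauss_fun t)).
Proof.
pose f (x t : R) := cos (x * t) * gauss_fun t.
have D (y t : R) : partial1of2 f y t = - (t * sin (y * t) * gauss_fun t).
  by rewrite partial1of2E; have [_ ->] := dpartial y t.
have H := @cvg_differentiation_under_integral R _ _ mu f setT measurableT x (x - 1) (x + 1) _
  (fun y _ => integrable_cosine_gauss y) _
  (fun t => `|t| * gauss_fun t) _ integrable_norm_gauss_fun _.
have {}H : h^-1 *: (cosine_gauss (h + x) - cosine_gauss x) @[h --> 0^'] -->
    - \int[mu]_t (t * sin (x * t) * gauss_fun t).
  have -> : - (\int[mu]_t (t * sin (x * t) * gauss_fun t)) =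
      \int[mu]_t (partial1of2 f x t).
    under [RHS]eq_Rintegral do rewrite D -mulN1r.
    by rewrite RintegralZl ?mulN1r//; exact: integrable_sine_gauss.
  apply: H.
  - by rewrite /= in_itv/=; lra.
  - by move=> y t _ _; have [] := dpartial y t.
  - by move=> t; rewrite mulr_ge0// gauss_fun_ge0.
  - move=> y t _ _; rewrite D normrN !normrM (ger0_norm (gauss_fun_ge0 _)).
    rewrite ler_wpM2r ?gauss_fun_ge0// ler_piMr// ler_norml sin_geN1 sin_le1//.
have E : (fun h => h^-1 *: (cosine_gauss (h + x) - cosine_gauss x)) =
  (fun h => h^-1 *: (cosine_gauss (h *: 1 + x) - cosine_gauss x)).
  by apply/funext => h; rewrite /GRing.scale/= mulr1.
rewrite E in H.
apply: DeriveDef; last exact: cvg_lim H.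
by apply/cvg_ex; eexists; exact: H.
Qed.

(** The integral of the derivative of sin (x t) exp (- t^2) vanishes. *)
Lemma sine_gaussE (x : R) :
  \int[mu]_t (t * sin (x * t) * gauss_fun t) = x / 2 * cosine_gauss x.
Proof.
have dG (t : R) : is_derive t 1 (fun t => sin (x * t) * gauss_fun t)
    (x * (cos (x * t) * gauss_fun t) - 2 * (t * sin (x * t) * gauss_fun t)).
  rewrite /gauss_fun; apply: is_derive_eq.
  rewrite /GRing.scale/=. ring.
have i1 := integrableZl measurableT x (integrable_cosine_gauss x).
have i2 := integrableZl measurableT 2 (integrable_sine_gauss x).
have lim0 (F : set_system R) : Filter F -> gauss_fun t @[t --> F] --> (0:R) ->
    (sin (x * t) * gauss_fun t) @[t --> F] --> (0:R).
  move=> FF gF; apply: norm_cvg0.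
  apply: (@squeeze_cvgr _ _ _ _ (cst 0) gauss_fun _ _ _ _ gF).
    apply: nearW => t; rewrite normr_ge0/= normrM (ger0_norm (gauss_fun_ge0 _)).
    by rewrite ler_piMl ?gauss_fun_ge0// ler_norml sin_geN1 sin_le1.
  exact: cvg_cst.
have := @integral_derivative_eq0 _ (fun t => sin (x * t) * gauss_fun t) _ _ dG
  (lim0 _ _ cvg_gauss_fun) (lim0 _ _ _).
rewrite RintegralB//.
rewrite RintegralZl//; last exact: integrable_cosine_gauss.
rewrite RintegralZl//; last exact: integrable_sine_gauss.
rewrite -/(cosine_gauss x) => H.
have {}H : x * cosine_gauss x - 2 * \int[mu]_t (t * sin (x * t) * gauss_fun t) = 0.
  apply: H => //.
  - move=> t; apply/differentiable_continuous/derivable1_diffP.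
    by rewrite /gauss_fun; exact: ex_derive.
  - exact: (integrableB _ i1 i2).
  - apply/cvgNy_compNP; rewrite /comp/= /gauss_fun.
    by under eq_fun do rewrite sqrrN; exact: cvg_gauss_fun.
apply: (mulfI (_ : 2 != 0 :> R)) => //.
have -> : 2 * (x / 2 * cosine_gauss x) = x * cosine_gauss x by field.
by apply/eqP; rewrite eq_sym -subr_eq0 H.
Qed.

(** The product with exp (x^2 / 4) has derivative zero, and the value at 0
    is the Gauss integral. *)
Lemma cosine_gaussE (x : R) :
  cosine_gauss x = Num.sqrt pi * expR (- (x ^+ 2 / 4)).
Proof.
have D (y : R) : is_derive y 1 (fun y => cosine_gauss y * expR (y ^+ 2 / 4)) 0.
  have := is_derive_cosine_gauss y; rewrite sine_gaussE => d.
  apply: is_derive_eq.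
  by rewrite /GRing.scale/=; field.
have := @is_derive_0_is_cst R _ x 0 D.
rewrite expr0n/= mul0r expR0 mulr1 {2}/cosine_gauss.
under eq_Rintegral do rewrite mul0r cos0 mul1r.
rewrite [X in _ = X]/Rintegral integralT_gauss /= => <-.
by rewrite -mulrA -expRD subrr expR0 mulr1.
Qed.

End gaussian_cosine.

(** * Gaussian integrals of 1 - cos on R^n *)

Section gaussian_cosine_nd.
Context {R : realType}.
Notation mu := (@lebesgue_measure R).

Lemma integral_opp (f : R -> \bar R) : measurable_fun setT f ->
  (\int[mu]_x f (- x)%R = \int[mu]_x f x)%E.
Proof.
move=> mf; rewrite integralE [RHS]integralE.
rewrite -(@ge0_integral_opp R (f^\+)%E)//; last exact: measurable_funepos.
rewrite -(@ge0_integral_opp R (f^\-)%E)//; last exact: measurable_funeneg.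
by congr (_ - _)%E; apply: eq_integral => x _; rewrite ?funeposE ?funenegE.
Qed.

Let mcosD (b x : R) : measurable_fun setT (fun t : R => cos (b + x * t)).
Proof.
apply: (measurableT_comp measurable_cos).
by apply: measurable_funD => //; exact: mulrl_measurable.
Qed.

Let integrable_sin_gauss (x : R) :
  mu.-integrable setT (fun t => (sin (x * t) * gauss_fun t)%:E).
Proof.
apply: (le_integrable _ _ _ integrableT_gauss) => //.
  apply/measurable_EFinP/measurable_funM; first exact: measurable_sinM.
  exact: measurable_gauss_fun.
move=> t _; rewrite !abse_EFin lee_fin normrM ler_piMl//.
by rewrite ler_norml sin_geN1 sin_le1.
Qed.

Let Rintegral_sin_gauss (x : R) : \int[mu]_t (sin (x * t) * gauss_fun t) = 0.
Proof.
have H : \int[mu]_t (sin (x * t) * gauss_fun t) =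
    - (\int[mu]_t (sin (x * t) * gauss_fun t)).
  rewrite -[RHS]mulN1r -RintegralZl//; last exact: integrable_sin_gauss.
  rewrite [LHS]/Rintegral -integral_opp; last first.
    apply/measurable_EFinP/measurable_funM; first exact: measurable_sinM.
    exact: measurable_gauss_fun.
  congr fine; apply: eq_integral => t _; congr EFin.
  by rewrite /gauss_fun sqrrN mulrN sinN mulN1r mulNr.
by move: H; set S : R := Rintegral _ _ _ => H; lra.
Qed.

(** The sine part of cos (b + x t) integrates to zero by parity. The factor
    c is there for the induction on the dimension: integrating out the other
    coordinates multiplies the cosine by an exponential in [0, 1]. *)
Lemma integral_cos_gauss (b c x w : R) : 0 < w -> 0 <= c -> c <= 1 ->
  (\int[mu]_t ((1 - c * cos (b + x * t)) * expR (- (t ^+ 2 / w ^+ 2)))%:E =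
   (Num.sqrt pi * w * (1 - c * (cos b * expR (- (x ^+ 2 * w ^+ 2 / 4)))))%:E)%E.
Proof.
move=> w0 c0 c1.
pose f (s : R) := (1 - c * cos (b + (x * w) * s)) * gauss_fun s.
have mf : measurable_fun setT f.
  apply: measurable_funM; last exact: measurable_gauss_fun.
  by apply: measurable_funB => //; apply: measurable_funM.
have f0 s : 0 <= f s.
  rewrite mulr_ge0 ?gauss_fun_ge0// subr_ge0 (@le_trans _ _ c)//.
  by rewrite ler_piMr// cos_le1.
have intf : mu.-integrable setT (EFin \o f).
  apply: (le_integrable _ _ _ (integrableZl measurableT 2 integrableT_gauss)) => //.
    exact/measurable_EFinP.
  move=> t _; rewrite /= lee_fin !normrM ler_wpM2r//.
  rewrite (le_trans (ler_normB _ _))// normr1 (ger0_norm (ler0n _ _)).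
  rewrite (_ : 2 = 1 + 1)// lerD2l normrM ger0_norm// mulr_ile1//.
  by rewrite ler_norml cos_geN1 cos_le1.
transitivity (\int[mu]_t (EFin \o f) (w^-1 * t)%R)%E.
  apply: eq_integral => t _; rewrite /= /f /gauss_fun exprMn exprVn.
  by congr ((1 - _ * cos _) * expR (- _))%:E; [field; lra | rewrite mulrC].
rewrite ge0_integral_scale ?invr_gt0//; last exact/measurable_EFinP.
rewrite invrK -[X in (_ * X)%E]fineK; last exact: integrable_fin_num.
rewrite -EFinM; congr EFin; rewrite -/(Rintegral _ _ _).
have -> : \int[mu]_t f t = \int[mu]_t ((gauss_fun t -
    c * cos b * (cos (x * w * t) * gauss_fun t)) +
    c * sin b * (sin (x * w * t) * gauss_fun t)).
  by apply: eq_Rintegral => t _; rewrite /f cosD; ring.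
have i0 := @integrableT_gauss R.
have i1 := integrableZl measurableT (c * cos b) (integrable_cosine_gauss (x * w)).
have i2 := integrableZl measurableT (c * sin b) (integrable_sin_gauss (x * w)).
have i3 := integrableB measurableT i0 i1.
rewrite RintegralD//.
rewrite RintegralB//.
rewrite (RintegralZl (c * cos b) measurableT (integrable_cosine_gauss _)).
rewrite (RintegralZl (c * sin b) measurableT (integrable_sin_gauss _)).
rewrite Rintegral_sin_gauss mulr0 addr0 -/(cosine_gauss _) cosine_gaussE.
rewrite {1}/Rintegral integralT_gauss/= exprMn. ring.
Qed.

Lemma euclid_dot_cons n (a b : R) (x y : n.-tuple R) :
  euclid_dot [tuple of a :: x] [tuple of b :: y] = a * b + euclid_dot x y.
Proof.
rewrite /euclid_dot big_ord_recl; congr (_ + _).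
by apply: eq_bigr => i _; rewrite !tnthS.
Qed.

Lemma measurable_euclid_dot d (T : measurableType d) n (f g : T -> n.-tuple R) :
  measurable_fun setT f -> measurable_fun setT g ->
  measurable_fun setT (fun x => euclid_dot (f x) (g x)).
Proof.
move=> mf mg; apply: measurable_sum => i; apply: measurable_funM.
  by apply: (measurableT_comp (measurable_tnth i)).
by apply: (measurableT_comp (measurable_tnth i)).
Qed.

Lemma euclid_dot_ge0 n (x : n.-tuple R) : 0 <= euclid_dot x x.
Proof. by rewrite sumr_ge0// => i _; rewrite -expr2 sqr_ge0. Qed.

(** The recursive definition of Lebesgue measure on R^n turned into an
    iterated integral; all inductions on the dimension go through it. *)
Lemma ge0_integral_lebesgue_tupleS n (f : n.+1.-tuple R -> \bar R) :
  measurable_fun setT f -> (forall x, (0 <= f x)%E) ->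
  (\int[lebesgue_tuple n.+1]_x f x =
   \int[mu]_a \int[lebesgue_tuple n]_y f [tuple of a :: y])%E.
Proof.
move=> mf f0.
transitivity (\int[pushforward (mu \x lebesgue_tuple n)
    (@tuple_cons R n)]_x f x)%E; first by [].
rewrite ge0_integral_pushforward//; last exact: measurable_tuple_cons.
rewrite preimage_setT fubini_tonelli1//.
  exact: (measurableT_comp mf (@measurable_tuple_cons R n)).
by move=> x; exact: f0.
Qed.

Let mker n (b c w : R) (x : n.-tuple R) : measurable_fun setT
  (fun t : n.-tuple R => ((1 - c * cos (b + euclid_dot t x)) *
     expR (- (euclid_dot t t / w ^+ 2)))%:E).
Proof.
apply/measurable_EFinP/measurable_funM.
  apply: measurable_funB => //; apply: measurable_funM => //.
  apply: (measurableT_comp measurable_cos).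
  by apply: measurable_funD => //; exact: measurable_euclid_dot.
apply: measurableT_comp => //; apply: measurableT_comp => //.
by apply: measurable_funM => //; exact: measurable_euclid_dot.
Qed.

(** Everything factorises over the coordinates except the cosine, so the
    induction carries an arbitrary phase b: the first coordinate is moved into
    it. The integrand is kept nonnegative so that Tonelli's theorem applies. *)
Lemma integral_tuple_cos_gauss n (b c w : R) (x : n.-tuple R) :
  0 < w -> 0 <= c -> c <= 1 ->
  (\int[lebesgue_tuple n]_t ((1 - c * cos (b + euclid_dot t x)) *
     expR (- (euclid_dot t t / w ^+ 2)))%:E =
   ((Num.sqrt pi * w) ^+ n *
    (1 - c * (cos b * expR (- (euclid_dot x x * w ^+ 2 / 4)))))%:E)%E.
Proof.
move=> w0; elim: n b c x => [|n IH] b c x c0 c1.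
  rewrite /= integral_dirac//=; last exact: mker.
  rewrite diracT mul1e.
  by rewrite /euclid_dot !big_ord0 addr0 !mul0r oppr0 expR0 expr0 mulr1 mul1r mulr1.
have [x0 [x' ->]] : exists (x0 : R) (x' : n.-tuple R), x = [tuple of x0 :: x'].
  by exists (thead x), [tuple of behead x]; exact: tuple_eta.
have cle (a : R) : c * cos a <= 1.
  by rewrite (@le_trans _ _ c)// ler_piMr// cos_le1.
rewrite ge0_integral_lebesgue_tupleS; last 2 first.
- exact: mker.
- by move=> t; rewrite lee_fin mulr_ge0 ?expR_ge0// subr_ge0.
under eq_integral => a _.
  under eq_integral => y _.
    (* the first coordinate only shifts the phase from b to b + a * x0 *)
    rewrite !euclid_dot_cons (_ : _ * _ =
      ((1 - c * cos ((b + a * x0) + euclid_dot y x')) *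
       expR (- (euclid_dot y y / w ^+ 2))) * expR (- (a ^+ 2 / w ^+ 2))); last first.
      by rewrite addrA -mulrA -expRD -opprD -mulrDl -expr2 (addrC (a ^+ 2)).
    rewrite EFinM.
    over.
  rewrite ge0_integralZr//; last 2 first.
  - exact: mker.
  - by move=> t _; rewrite lee_fin mulr_ge0 ?expR_ge0// subr_ge0.
  rewrite IH// -EFinM.
  rewrite [X in EFin X](_ : _ = (Num.sqrt pi * w) ^+ n *
    ((1 - (c * expR (- (euclid_dot x' x' * w ^+ 2 / 4))) * cos (b + x0 * a)) *
     expR (- (a ^+ 2 / w ^+ 2)))); last first.
    by rewrite (mulrC x0) expr2; ring.
  rewrite EFinM.
  over.
set e := expR (- (euclid_dot x' x' * w ^+ 2 / 4)).
have e0 : 0 <= e by exact: expR_ge0.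
have e1 : e <= 1.
  by rewrite -expR0 ler_expR lerNl oppr0 divr_ge0// mulr_ge0 ?sqr_ge0 ?euclid_dot_ge0.
have ce1 : c * e <= 1 by rewrite mulr_ile1.
rewrite ge0_integralZl//; last 3 first.
- apply/measurable_EFinP/measurable_funM.
    apply: measurable_funB; first exact: measurable_cst.
    apply: measurable_funM; first exact: measurable_cst.
    exact: mcosD.
  apply: measurableT_comp => //; apply: measurableT_comp => //.
  by apply: measurable_funM => //.
- move=> t _; rewrite lee_fin mulr_ge0 ?expR_ge0// subr_ge0.
  by rewrite (@le_trans _ _ (c * e))// ler_piMr ?mulr_ge0// cos_le1.
- by rewrite lee_fin exprn_ge0// mulr_ge0 ?sqrtr_ge0 ?ltW.
rewrite integral_cos_gauss ?mulr_ge0// -EFinM; congr EFin.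
rewrite euclid_dot_cons mulrDl mulrDl opprD expRD -/e (exprS _ n) -expr2; ring.
Qed.

End gaussian_cosine_nd.

(** * The substitution v = 1 / w^2 on the half-line *)

Section inverse_square_substitution.
Context {R : realType}.
Notation mu := (@lebesgue_measure R).

Let F (w : R) : R := (w ^+ 2)^-1.
Let F' (w : R) : R := - (2 * (w ^+ 3)^-1).

Let dF (w : R) : w != 0 -> is_derive w 1 F (F' w).
Proof.
move=> w0; have w20 : w ^+ 2 != 0 by rewrite expf_neq0.
rewrite /F; apply: is_derive_eq.
by rewrite /F' /GRing.scale/=; field.
Qed.

Let FE (w : R) : w != 0 -> F^`()%classic w = F' w.
Proof. by move=> w0; rewrite derive1E; have [_ ->] := dF w0. Qed.

Let cF' (w : R) : w != 0 -> {for w, continuous F'}.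
Proof.
move=> w0; apply: continuousN; apply: continuousM; first exact: cst_continuous.
apply: continuousV; first by rewrite expf_neq0.
exact: exprn_continuous.
Qed.

Let nearFE (w : R) : 0 < w -> \forall x \near w, F' x = F^`()%classic x.
Proof. by move=> w0; near=> x; rewrite FE// gt_eqF//; near: x; exact: lt_nbhsr. 
Unshelve. all: by end_near. Qed.

Let cdF (w : R) : 0 < w -> F^`()%classic x @[x --> w] --> F' w.
Proof.
move=> w0; apply: cvg_trans (cF' (lt0r_neq0 w0)).
apply: near_eq_cvg; exact: nearFE.
Qed.

Let cF (w : R) : w != 0 -> {for w, continuous F}.
Proof.
move=> w0; apply: continuousV; first by rewrite expf_neq0.
exact: exprn_continuous.
Qed.

Let itv_cover (f : nat -> R) : (forall n, 0 < f n) -> f @ \oo --> +oo ->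
  `]0, +oo[%classic = \bigcup_i `[(f i)^-1, f i]%classic.
Proof.
move=> f0 fy; apply/seteqP; split => [x|x [i _]]/=; last first.
  by rewrite !in_itv/= andbT => /andP[+ _]; apply: lt_le_trans; rewrite invr_gt0.
rewrite in_itv/= andbT => x0.
have [i ix] : exists i, x + x^-1 <= f i.
  move/cvgryPge : fy => /(_ (x + x^-1))[i _ H]; exists i; exact: (H i (leqnn i)).
exists i => //=; rewrite in_itv/=; apply/andP; split.
  rewrite -[leRHS]invrK lef_pV2 ?posrE ?invr_gt0//.
  by apply: le_trans ix; rewrite lerDr ltW.
by apply: le_trans ix; rewrite lerDl invr_ge0 ltW.
Qed.

(** The substitution is performed on compact intervals [1 / a, a], where all
    functions are continuous, and the intervals then exhaust the half-line; this
    avoids the singularity of v = 1 / w^2 at the origin. *)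
Lemma ge0_integration_by_substitution_invsqr (G : R -> R) :
  (forall v, 0 < v -> {for v, continuous G}) ->
  (forall v, 0 < v -> 0 <= G v) ->
  (\int[mu]_(v in `]0%R, +oo[) (G v)%:E =
   \int[mu]_(w in `]0%R, +oo[) (2 * (w ^+ 3)^-1 * G ((w ^+ 2)^-1))%:E)%E.
Proof.
move=> cG G0.
pose a (i : nat) : R := i.+1%:R.
pose A (i : nat) : set R := `[(a i)^-1, a i]%classic.
pose b (i : nat) : R := (a i) ^+ 2.
pose B (i : nat) : set R := `[(b i)^-1, b i]%classic.
have i0 (i : nat) : 0 < a i by rewrite ltr0n.
have Ay : a i @[i --> \oo] --> +oo.
  apply/cvgryPge => M; near=> n; rewrite (@le_trans _ _ n%:R)// ?ler_nat//.
  by near: n; exact: nbhs_infty_ger.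
have EA : `]0, +oo[%classic = \bigcup_i A i.
  by rewrite (@itv_cover a).
have EB : `]0, +oo[%classic = \bigcup_i B i.
  rewrite (@itv_cover b)//; first by move=> n; rewrite exprn_gt0.
  apply/cvgryPge => M; near=> n; rewrite (@le_trans _ _ n.+1%:R)//.
    by near: n; move/cvgryPge : Ay; exact.
  by rewrite /b expr2 ler_peMr// ler1n.
have ndA : nondecreasing_seq A.
  move=> i j ij; apply/subsetPset => x; rewrite /A/= !in_itv/= => /andP[x1 x2].
  apply/andP; split; last by rewrite (le_trans x2)// ler_nat ltnS.
  by apply: le_trans x1; rewrite lef_pV2 ?posrE ?i0// ler_nat ltnS.
have ndB : nondecreasing_seq B.
  move=> i j ij; apply/subsetPset => x; rewrite /B/= !in_itv/= => /andP[x1 x2].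
  have ij2 : (i.+1%:R : R) ^+ 2 <= j.+1%:R ^+ 2.
    by rewrite lerXn2r ?nnegrE ?ler0n// ler_nat ltnS.
  apply/andP; split; last by rewrite (le_trans x2).
  by apply: le_trans x1; rewrite lef_pV2 ?posrE ?exprn_gt0.
pose G' w := 2 * (w ^+ 3)^-1 * G ((w ^+ 2)^-1).
have cG' w : 0 < w -> {for w, continuous G'}.
  move=> w0; apply: continuousM.
    apply: continuousM; first exact: cst_continuous.
    apply: continuousV; first by rewrite expf_neq0// gt_eqF.
    exact: exprn_continuous.
  apply: (@continuous_comp _ _ _ F G); first by apply: cF; rewrite gt_eqF.
  by apply: cG; rewrite invr_gt0 exprn_gt0.
have AS i x : A i x -> 0 < x.
  by rewrite /A/= in_itv/= => /andP[+ _]; apply: lt_le_trans; rewrite invr_gt0 i0.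
have BS i x : B i x -> 0 < x.
  by rewrite /B/= in_itv/= => /andP[+ _]; apply: lt_le_trans; rewrite invr_gt0 exprn_gt0 ?i0.
have meas (H : R -> R) : (forall v, 0 < v -> {for v, continuous H}) ->
    measurable_fun (`]0, +oo[%classic : set R) H.
  move=> cH; apply: open_continuous_measurable_fun; first exact: interval_open.
  by move=> x; rewrite inE/= in_itv/= andbT => x0; exact: cH.
have subA i : A i `<=` (`]0, +oo[%classic : set R).
  by move=> x /AS; rewrite /= in_itv/= andbT.
have subB i : B i `<=` (`]0, +oo[%classic : set R).
  by move=> x /BS; rewrite /= in_itv/= andbT.
have LB : (\int[mu]_(x in B i) (G x)%:E)%E @[i --> \oo] -->
    (\int[mu]_(x in \bigcup_i B i) (G x)%:E)%E.
  apply: ge0_nondecreasing_set_cvg_integral => //.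
  - by move=> i; exact: measurable_itv.
  - move=> i; apply: (@measurable_funS _ _ _ _ (`]0, +oo[%classic : set R)) => //.
    by apply/measurable_EFinP; exact: (meas _ cG).
  - by move=> i x /BS x0; rewrite lee_fin G0.
have LA : (\int[mu]_(x in A i) (G' x)%:E)%E @[i --> \oo] -->
    (\int[mu]_(x in \bigcup_i A i) (G' x)%:E)%E.
  apply: ge0_nondecreasing_set_cvg_integral => //.
  - by move=> i; exact: measurable_itv.
  - move=> i; apply: (@measurable_funS _ _ _ _ (`]0, +oo[%classic : set R)) => //.
    by apply/measurable_EFinP; exact: (meas _ cG').
  - move=> i x /AS x0; rewrite lee_fin mulr_ge0 ?G0 ?invr_gt0 ?exprn_gt0//.
    by rewrite mulr_ge0// invr_ge0 exprn_ge0// ltW.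
rewrite -EB in LB; rewrite -EA in LA; apply: (cvg_unique _ LB) => //.
suff E : (fun i => \int[mu]_(x in B i) (G x)%:E)%E =
  (fun i => \int[mu]_(x in A i) (G' x)%:E)%E by rewrite E; exact: LA.
apply/funext => i; have i1 : 0 < (a i)^-1 by rewrite invr_gt0 i0.
have Apos x : x \in `](a i)^-1, a i[ -> 0 < x.
  by rewrite in_itv/= => /andP[+ _]; apply: lt_trans.
have := @integration_by_substitution_decreasing R F G (a i)^-1 (a i).
have FB : F (a i) = (b i)^-1 by [].
have FA : F (a i)^-1 = b i by rewrite /F exprVn invrK.
rewrite FB FA => ->.
- apply: eq_integral => w /set_mem /AS w0; congr EFin.
  by rewrite !fctE FE ?gt_eqF// /F' opprK mulrC.
- by rewrite (@le_trans _ _ 1)// ?ler1n// invf_le1// ler1n.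
- move=> x y; rewrite !in_itv/= => /andP[x1 x2] /andP[y1 y2] xy.
  have x0 := lt_le_trans i1 x1; have y0 := lt_le_trans i1 y1.
  by rewrite /F ltf_pV2 ?posrE ?exprn_gt0// ltrXn2r// ltW.
- move=> x /Apos x0; rewrite /prop_for/continuous_at FE ?gt_eqF//; exact: cdF.
- by apply/cvg_ex; eexists; apply: cvg_at_right_filter; exact: cdF.
- by apply/cvg_ex; eexists; apply: cvg_at_left_filter; exact: cdF.
- split.
  + by move=> x /Apos x0; have [] := @dF x (lt0r_neq0 x0).
  + by apply: cvg_at_right_filter; apply: cF; rewrite gt_eqF.
  + by apply: cvg_at_left_filter; apply: cF; rewrite gt_eqF.
- apply: continuous_in_subspaceT => x /set_mem; rewrite /= => xB.
  by apply: cG; exact: (BS i).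
Unshelve. all: by end_near. Qed.

End inverse_square_substitution.

(** * Powers as mixtures of Gaussians *)

Section tonelli_in.
Context d1 d2 (T1 : measurableType d1) (T2 : measurableType d2) (R : realType).
Variable m1 : {sigma_finite_measure set T1 -> \bar R}.
Variable m2 : {sigma_finite_measure set T2 -> \bar R}.

Lemma fubini_tonelli_in (D1 : set T1) (D2 : set T2) (f : T1 * T2 -> \bar R) :
  measurable D1 -> measurable D2 -> measurable_fun (D1 `*` D2) f ->
  (forall p, (0 <= f p)%E) ->
  (\int[m1]_(x in D1) \int[m2]_(y in D2) f (x, y) =
   \int[m2]_(y in D2) \int[m1]_(x in D1) f (x, y))%E.
Proof.
move=> mD1 mD2 mf f0; pose g := f \_ (D1 `*` D2).
have mg : measurable_fun setT g.
  by apply/(measurable_restrictT _ _).1 => //; exact: measurableX.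
have g0 p : (0 <= g p)%E by rewrite /g patchE; case: ifP.
transitivity (\int[m1]_x \int[m2]_y g (x, y))%E.
  rewrite integral_mkcond; apply: eq_integral => x _.
  rewrite patchE; case: ifPn => xD1.
    rewrite integral_mkcond; apply: eq_integral => y _.
    by rewrite /g !patchE in_setX/= xD1.
  rewrite integral0_eq// => y _.
  by rewrite /g patchE in_setX/= (negbTE xD1).
rewrite (fubini_tonelli g mg g0); apply/esym.
rewrite integral_mkcond; apply: eq_integral => y _.
rewrite patchE; case: ifPn => yD2.
  rewrite integral_mkcond; apply: eq_integral => x _.
  by rewrite /g !patchE in_setX/= yD2 andbT.
rewrite integral0_eq// => x _.
by rewrite /g patchE in_setX/= (negbTE yD2) andbF.
Qed.

End tonelli_in.

Section gamma_mixture.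
Context {R : realType}.
Notation mu := (@lebesgue_measure R).

Lemma ge0_integral_scale_pos (a : R) (f : R -> \bar R) : 0 < a ->
  measurable_fun (`]0, +oo[%classic : set R) f ->
  (forall x, 0 < x -> (0 <= f x)%E) ->
  (\int[mu]_(x in `]0%R, +oo[) f (a * x)%R =
   a^-1%:E * \int[mu]_(x in `]0%R, +oo[) f x)%E.
Proof.
move=> a0 mf f0.
rewrite [in RHS]integral_mkcond -ge0_integral_scale//.
- rewrite integral_mkcond; apply: eq_integral => x _.
  by rewrite !patchE !mem_setE !in_itv/= !andbT pmulr_rgt0.
- by apply/(measurable_restrictT _ _).1 => //; exact: measurable_itv.
- move=> x; rewrite patchE; case: ifPn => // /set_mem.
  by rewrite /= in_itv/= andbT => /f0.
Qed.

(** This is Gamma ((1 + n) / 2), kept as an extended real because its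
    finiteness is only a consequence of [egamma_half_cosine]. *)
Definition egamma_half (n : nat) : \bar R :=
  \int[mu]_(t in `]0%R, +oo[) (t `^ ((1 + n%:R) / 2 - 1) * expR (- t))%:E.

Let mpos (H : R -> R) : (forall v, 0 < v -> {for v, continuous H}) ->
  measurable_fun (`]0, +oo[%classic : set R) H.
Proof.
move=> cH; apply: open_continuous_measurable_fun; first exact: interval_open.
by move=> x; rewrite inE/= in_itv/= andbT => x0; exact: cH.
Qed.

Let kern n (q w : R) : R := 2 * (w ^+ n.+2)^-1 * expR (- (q ^+ 2 / w ^+ 2)).

Let ckern n (q w : R) : 0 < w -> {for w, continuous (kern n q)}.
Proof.
move=> w0; apply: continuousM.
  apply: continuousM; first exact: cst_continuous.
  apply: continuousV; first by rewrite expf_neq0// gt_eqF.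
  exact: exprn_continuous.
apply: continuous_comp; last exact: continuous_expR.
apply: continuousN; apply: continuousM; first exact: cst_continuous.
apply: continuousV; first by rewrite expf_neq0// gt_eqF.
exact: exprn_continuous.
Qed.

Lemma egamma_halfE n :
  egamma_half n = (\int[mu]_(w in `]0%R, +oo[) (kern n 1 w)%:E)%E.
Proof.
rewrite /egamma_half (@ge0_integration_by_substitution_invsqr R
  (fun t => t `^ ((1 + n%:R) / 2 - 1) * expR (- t))).
- apply: eq_integral => w /set_mem; rewrite /= in_itv/= andbT => w0.
  congr EFin; rewrite /kern mulrA expr1n mul1r; congr (_ * _).
  rewrite -mulrA; congr (2 * _).
  rewrite -(powR_mulrn 2 (ltW w0)) -(powR_mulrn 3 (ltW w0)).
  rewrite -(powR_mulrn n.+2 (ltW w0)) -!powRN -powRrM.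
  rewrite -powRD; last by rewrite (gt_eqF w0) implybT.
  by congr powR; rewrite -[n.+2]addn2 natrD; field.
- move=> v v0; apply: continuousM.
    apply/differentiable_continuous/derivable1_diffP.
    by apply: derivable_powR; rewrite in_itv/= v0.
  apply: continuous_comp; last exact: continuous_expR.
  exact: continuousN.
- by move=> v v0; rewrite mulr_ge0 ?powR_ge0 ?expR_ge0.
Qed.

(** This writes q^-(n+1) as a mixture of the Gaussians exp (- q^2 / w^2)
    with a weight that is an integer power of w, by scaling w in the integral
    for Gamma. *)
Lemma egamma_half_mixture n (q : R) : 0 < q ->
  (\int[mu]_(w in `]0%R, +oo[) (kern n q w)%:E =
   egamma_half n * ((q ^+ n.+1)^-1)%:E)%E.
Proof.
move=> q0.
have -> : (\int[mu]_(w in `]0%R, +oo[) (kern n q w)%:E =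
    \int[mu]_(w in `]0%R, +oo[) ((q ^+ n.+2)^-1%:E * (kern n 1 (q^-1 * w))%:E))%E.
  apply: eq_integral => w /set_mem; rewrite /= in_itv/= andbT => w0.
  rewrite -EFinM; congr EFin; rewrite /kern.
  have qn0 : q != 0 by rewrite gt_eqF.
  have wn0 : w != 0 by rewrite gt_eqF.
  have -> : 1 ^+ 2 / (q^-1 * w) ^+ 2 = q ^+ 2 / w ^+ 2.
    by field; rewrite qn0 wn0.
  move: n.+2 => k; rewrite mulrA; congr (_ * _); rewrite exprMn exprVn.
  by field; rewrite !expf_neq0.
have k0 w : 0 < w -> (0 <= (kern n 1 w)%:E)%E.
  by move=> w0; rewrite lee_fin !mulr_ge0 ?expR_ge0// invr_ge0 exprn_ge0// ltW.
have mk : measurable_fun (`]0, +oo[%classic : set R) (EFin \o kern n 1).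
  by apply/measurable_EFinP; apply: mpos => v; exact: ckern.
rewrite ge0_integralZl; last 4 first.
- exact: measurable_itv.
- apply/measurable_EFinP.
  apply: (@mpos (fun x => kern n 1 (q^-1 * x))) => v v0.
  apply: continuous_comp; first exact: mulrl_continuous.
  by apply: ckern; rewrite mulr_gt0// invr_gt0.
- move=> w; rewrite /= in_itv/= andbT => w0; apply: k0.
  by rewrite mulr_gt0// invr_gt0.
- by rewrite lee_fin invr_ge0 exprn_ge0// ltW.
rewrite (@ge0_integral_scale_pos q^-1 (EFin \o kern n 1)) ?invr_gt0//.
rewrite -egamma_halfE invrK muleA -EFinM muleC; congr (_ * _%:E)%E.
have qn0 : q != 0 by rewrite gt_eqF.
have qk0 : q ^+ n.+1 != 0 by rewrite expf_neq0.
by rewrite [q ^+ n.+2]exprS; move: (q ^+ n.+1) qk0 => k k0'; field; rewrite qn0 k0'.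
Qed.

Let onemE (b w : R) : 0 < w -> 0 <= b ->
  (\int[mu]_(y in `[0%R, 1%R]) (2 * (b * w) ^+ 2 * y * expR (- ((b * w * y) ^+ 2)))%:E =
   (1 - expR (- (b * w) ^+ 2))%:E)%E.
Proof.
move=> w0 b0.
have D (y : R) : is_derive y 1 (fun y => - expR (- ((b * w * y) ^+ 2)))
   (2 * (b * w) ^+ 2 * y * expR (- ((b * w * y) ^+ 2))).
  apply: is_derive_eq; rewrite /GRing.scale/=; ring.
rewrite (@continuous_FTC2 _ _ (fun y => - expR (- ((b * w * y) ^+ 2)))) ?ltr01//.
- by rewrite mulr1 mulr0 expr0n/= oppr0 expR0 -EFinB opprK addrC.
- apply: continuous_subspaceT => y.
  apply/differentiable_continuous/derivable1_diffP; exact: ex_derive.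
- have dr x : derivable (fun y => - expR (- ((b * w * y) ^+ 2))) x 1 by have [] := D x.
  have cG x : {for x, continuous (fun y => - expR (- ((b * w * y) ^+ 2)))}.
    exact/differentiable_continuous/derivable1_diffP.
  split => //; [exact/cvg_at_right_filter/cG|exact/cvg_at_left_filter/cG].
- by move=> y _; rewrite derive1E; have [_ ->] := D y.
Qed.

(** With 1 - exp (- b^2 w^2) the integral over y in [0, 1] of the derivative
    of - exp (- b^2 w^2 y^2), Tonelli's theorem leaves for each y a Gaussian
    integral in w, whose value does not depend on y. *)
Lemma integral_onem_gauss (b : R) : 0 <= b ->
  (\int[mu]_(w in `]0%R, +oo[) (2 * (w ^+ 2)^-1 * (1 - expR (- (b * w) ^+ 2)))%:E =
   (2 * b * Num.sqrt pi)%:E)%E.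
Proof.
rewrite le_eqVlt => /predU1P[<-|b0].
  rewrite mulr0 mul0r integral0_eq// => w _.
  by rewrite mul0r expr0n/= oppr0 expR0 subrr mulr0.
pose f (p : R * R) := 4 * b ^+ 2 * p.1 * expR (- ((b * p.1 * p.2) ^+ 2)).
transitivity (\int[mu]_(w in `]0%R, +oo[) \int[mu]_(y in `]0%R, 1%R]) `|f (y, w)|%:E)%E.
  apply: eq_integral => w /set_mem; rewrite /= in_itv/= andbT => w0.
  have -> : (2 * (w ^+ 2)^-1 * (1 - expR (- (b * w) ^+ 2)))%:E =
    ((2 * (w ^+ 2)^-1)%:E * (1 - expR (- (b * w) ^+ 2))%:E)%E by rewrite EFinM.
  have mg (D : set R) : measurable_fun D
      (fun y : R => (2 * (b * w) ^+ 2 * y * expR (- (b * w * y) ^+ 2))%:E).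
    apply: measurable_funTS; apply/measurable_EFinP; apply: measurable_funM.
      exact: mulrl_measurable.
    apply: measurableT_comp => //; apply: measurableT_comp => //.
    by apply: measurable_funX; exact: mulrl_measurable.
  rewrite -onemE ?ltW// -ge0_integralZl//.
  - rewrite -integral_itv_obnd_cbnd; last by apply: measurable_funeM; exact: mg.
    apply: eq_integral => y /set_mem; rewrite /= in_itv/= => /andP[y0 _].
    rewrite -EFinM ger0_norm; last first.
      by rewrite /f !mulr_ge0 ?expR_ge0 ?sqr_ge0// ltW.
    rewrite /f/= (_ : b * y * w = b * w * y); last by rewrite mulrAC.
    congr EFin; rewrite mulrA; congr (_ * _).
    by field; rewrite gt_eqF.
  - exact: mg.
  - move=> y; rewrite /= in_itv/= => /andP[y0 _].
    by rewrite lee_fin mulr_ge0 ?expR_ge0// mulr_ge0// mulr_ge0// sqr_ge0.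
  - by rewrite lee_fin mulr_ge0// invr_ge0 sqr_ge0.
have mf : measurable_fun setT (fun p : R * R => `|f p|%:E).
  apply/measurable_EFinP; apply: measurableT_comp => //.
  apply: measurable_funM.
    by apply: measurable_funM => //; exact: measurable_fst.
  apply: measurableT_comp => //; apply: measurableT_comp => //.
  apply: measurable_funX.
  apply: measurable_funM; last exact: measurable_snd.
  by apply: measurable_funM => //; exact: measurable_fst.
transitivity (\int[mu]_(y in `]0%R, 1%R]) \int[mu]_(w in `]0%R, +oo[) `|f (y, w)|%:E)%E.
  apply/esym; apply: (@fubini_tonelli_in _ _ (measurableTypeR R) (measurableTypeR R)
    R mu mu _ _ (fun p => `|f p|%:E)).
  - exact: measurable_itv.
  - exact: measurable_itv.
  - exact: measurable_funTS mf.
  - by move=> p; rewrite lee_fin.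
transitivity (\int[mu]_(y in `]0%R, 1%R]) (2 * b * Num.sqrt pi)%:E)%E; last first.
  by rewrite integral_cst//= lebesgue_measure_itv/= lte01 oppr0 adde0 mule1.
apply: eq_integral => y /set_mem; rewrite /= in_itv/= => /andP[y0 _].
have by0 : 0 < b * y by rewrite mulr_gt0.
transitivity (\int[mu]_(w in `]0%R, +oo[)
    ((4 * b ^+ 2 * y)%:E * (EFin \o gauss_fun) (b * y * w)%R))%E.
  apply: eq_integral => w _; rewrite /= -EFinM; congr EFin.
  by rewrite ger0_norm// /f/= !mulr_ge0 ?expR_ge0 ?sqr_ge0// ltW.
have mga : measurable_fun setT (fun w : R => (gauss_fun (b * y * w))%:E).
  apply/measurable_EFinP; apply: (measurableT_comp (@measurable_gauss_fun R)).
  exact: mulrl_measurable.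
rewrite ge0_integralZl; last 4 first.
- exact: measurable_itv.
- exact: measurable_funTS.
- by move=> w _; rewrite lee_fin gauss_fun_ge0.
- by rewrite lee_fin !mulr_ge0 ?sqr_ge0// ltW.
rewrite ge0_integral_scale_pos//; last 2 first.
- by apply: measurable_funTS; apply/measurable_EFinP; exact: measurable_gauss_fun.
- by move=> w _; rewrite lee_fin gauss_fun_ge0.
rewrite integral_itv_obnd_cbnd; last first.
  by apply: measurable_funTS; apply/measurable_EFinP; exact: measurable_gauss_fun.
rewrite integral0y_gauss -!EFinM; congr EFin.
by field; rewrite !gt_eqF.
Qed.

End gamma_mixture.

(** * The Euclidean norm as an integral of 1 - cos *)

Section cosine_kernel.
Context {R : realType}.
Notation mu := (@lebesgue_measure R).

Lemma euclid_norm_ge0 n (x : n.-tuple R) : 0 <= euclid_norm x.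
Proof. exact: sqrtr_ge0. Qed.

Lemma sqr_euclid_norm n (x : n.-tuple R) : euclid_norm x ^+ 2 = euclid_dot x x.
Proof. by rewrite sqr_sqrtr// euclid_dot_ge0. Qed.

Lemma euclid_norm_eq0_dot n (t x : n.-tuple R) : euclid_norm t = 0 -> euclid_dot t x = 0.
Proof.
move=> t0; have := sqr_euclid_norm t; rewrite t0 expr0n/= => /esym/eqP.
rewrite psumr_eq0 => [/allP H|i _]; last by rewrite -expr2 sqr_ge0.
apply: big1 => i _; have := H i (mem_index_enum _).
by rewrite /= -expr2 sqrf_eq0 => /eqP ->; rewrite mul0r.
Qed.

Lemma measurable_euclid_norm d (T : measurableType d) n (f : T -> n.-tuple R) :
  measurable_fun setT f -> measurable_fun setT (fun x => euclid_norm (f x)).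
Proof.
move=> mf; apply: (measurableT_comp (continuous_measurable_fun (@sqrt_continuous R))).
exact: measurable_euclid_dot.
Qed.

(** Written as x times (x^2)^-1, which is also right at 0, the inverse only
    involves a real power of a nonnegative number. *)
Lemma measurable_invr : measurable_fun setT (fun x : R => x^-1).
Proof.
have -> : (fun x : R => x^-1) = (fun x => x * (x ^+ 2) `^ (- 1)).
  apply/funext => x; rewrite powR_inv1 ?sqr_ge0//.
  have [->|x0] := eqVneq x 0; first by rewrite invr0 mul0r.
  by field.
apply: measurable_funM => //.
apply: (measurableT_comp (measurable_powR _)); exact: measurable_funX.
Qed.

Lemma measurable_expVn d (T : measurableType d) (f : T -> R) k :
  measurable_fun setT f -> measurable_fun setT (fun x => (f x ^+ k)^-1).
Proof.
by move=> mf; apply: (measurableT_comp measurable_invr (measurable_funX k mf)).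
Qed.

(** The power of the norm is replaced by its Gaussian mixture; exchanging
    the integrals makes the t-integral explicit, and the remaining integral over
    w is that of [integral_onem_gauss] with b half the norm of x. At the points
    where the norm of t vanishes both sides of the exchange are 0, since then
    1 - cos <t, x> = 0. *)
Lemma egamma_half_cosine n (x : n.-tuple R) :
  (egamma_half n * \int[lebesgue_tuple n]_t
     ((1 - cos (euclid_dot t x)) / euclid_norm t ^+ n.+1)%:E =
   (Num.sqrt pi ^+ n.+1 * euclid_norm x)%:E)%E.
Proof.
have eg0 : (0 <= @egamma_half R n)%E.
  by apply: integral_ge0 => t _; rewrite lee_fin mulr_ge0 ?powR_ge0 ?expR_ge0.
have c0 (a : R) : 0 <= 1 - cos a by rewrite subr_ge0 cos_le1.
have mc : measurable_fun setT (fun t : n.-tuple R => 1 - cos (euclid_dot t x)).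
  apply: measurable_funB => //; apply: (measurableT_comp measurable_cos).
  exact: measurable_euclid_dot.
rewrite -ge0_integralZl//; last 2 first.
- apply/measurable_EFinP; apply: measurable_funM => //.
  by apply: measurable_expVn; exact: measurable_euclid_norm.
- move=> t _; rewrite lee_fin mulr_ge0// invr_ge0 exprn_ge0//.
  exact: euclid_norm_ge0.
pose h (p : n.-tuple R * R) : R := (1 - cos (euclid_dot p.1 x)) *
  (2 * (`|p.2| ^+ n.+2)^-1 * expR (- (euclid_norm p.1 ^+ 2 / p.2 ^+ 2))).
have h0 p : 0 <= h p.
  by rewrite mulr_ge0// !mulr_ge0 ?expR_ge0// invr_ge0 exprn_ge0.
have mh : measurable_fun setT (EFin \o h).
  apply/measurable_EFinP; apply: measurable_funM.
    exact: (measurableT_comp mc measurable_fst).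
  apply: measurable_funM.
    apply: measurable_funM => //; apply: measurable_expVn.
    exact: (measurableT_comp (@normr_measurable R setT) measurable_snd).
  apply: measurableT_comp => //; apply: measurableT_comp => //.
  apply: measurable_funM.
    by apply: measurable_funX; apply: measurable_euclid_norm; exact: measurable_fst.
  by apply: measurable_expVn; exact: measurable_snd.
transitivity (\int[lebesgue_tuple n]_t \int[mu]_(w in `]0%R, +oo[) (h (t, w))%:E)%E.
  apply: eq_integral => t _.
  have [t0|t0] := eqVneq (euclid_norm t) 0.
    rewrite euclid_norm_eq0_dot// cos0 subrr mul0r mule0 integral0_eq// => w _.
    by rewrite /h/= euclid_norm_eq0_dot// cos0 subrr mul0r.
  have tp : 0 < euclid_norm t by rewrite lt_neqAle eq_sym t0 euclid_norm_ge0.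
  rewrite mulrC EFinM muleA -egamma_half_mixture//.
  rewrite muleC -ge0_integralZl//.
  - apply: eq_integral => w /set_mem; rewrite /= in_itv/= andbT => w0.
    by rewrite -EFinM /h/= gtr0_norm.
  - apply/measurable_EFinP; apply: measurable_funTS; apply: measurable_funM.
      by apply: measurable_funM => //; exact: measurable_expVn.
    apply: measurableT_comp => //; apply: measurableT_comp => //.
    by apply: measurable_funM => //; exact: measurable_expVn.
  - move=> w; rewrite /= in_itv/= andbT => w0.
    by rewrite lee_fin !mulr_ge0 ?expR_ge0// invr_ge0 exprn_ge0// ltW.
transitivity (\int[mu]_(w in `]0%R, +oo[) \int[lebesgue_tuple n]_t (h (t, w))%:E)%E.
  apply: (@fubini_tonelli_in _ _ _ (measurableTypeR R) R (lebesgue_tuple n) mu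
    setT _ (EFin \o h)) => //.
  exact: measurable_funTS mh.
transitivity (\int[mu]_(w in `]0%R, +oo[) ((Num.sqrt pi ^+ n)%:E *
    (2 * (w ^+ 2)^-1 * (1 - expR (- (euclid_norm x / 2 * w) ^+ 2)))%:E))%E.
  apply: eq_integral => w /set_mem; rewrite /= in_itv/= andbT => w0.
  have := integral_tuple_cos_gauss 0 x w0 ler01 (lexx 1).
  rewrite cos0 !mul1r => H.
  transitivity (\int[lebesgue_tuple n]_t ((2 * (w ^+ n.+2)^-1)%:E *
      ((1 - 1 * cos (0 + euclid_dot t x)) *
     expR (- (euclid_dot t t / w ^+ 2)))%:E))%E.
    apply: eq_integral => t _; rewrite -EFinM; congr EFin.
    by rewrite /h/= sqr_euclid_norm add0r mul1r gtr0_norm// mulrCA mulrA.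
  rewrite ge0_integralZl; last 4 first.
  - exact: measurableT.
  - apply/measurable_EFinP; apply: measurable_funM.
      under eq_fun do rewrite mul1r add0r; exact: mc.
    apply: measurableT_comp => //; apply: measurableT_comp => //.
    by apply: measurable_funM => //; exact: measurable_euclid_dot.
  - by move=> t _; rewrite lee_fin mul1r mulr_ge0 ?expR_ge0.
  - by rewrite lee_fin mulr_ge0// invr_ge0 exprn_ge0// ltW.
  rewrite H -!EFinM; congr EFin.
  rewrite !exprMn exprVn sqr_euclid_norm (_ : 2 ^- 2 = 4^-1 :> R); last first.
    by congr (_^-1); ring.
  rewrite (mulrAC _ 4^-1) !exprS.
  have wk0 : w ^+ n != 0 by rewrite expf_neq0// gt_eqF.
  move: (w ^+ n) wk0 => k k0; field.
  by rewrite k0 gt_eqF.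
rewrite ge0_integralZl; last 4 first.
- exact: measurable_itv.
- apply/measurable_EFinP; apply: measurable_funTS; apply: measurable_funM.
    by apply: measurable_funM => //; exact: measurable_expVn.
  apply: measurable_funB => //.
  apply: measurableT_comp => //; apply: measurableT_comp => //.
  by apply: measurable_funX; exact: mulrl_measurable.
- move=> w; rewrite /= in_itv/= andbT => w0.
  rewrite lee_fin mulr_ge0//; first by rewrite mulr_ge0// invr_ge0 sqr_ge0.
  by rewrite subr_ge0 -expR0 ler_expR lerNl oppr0 sqr_ge0.
- by rewrite lee_fin exprn_ge0// sqrtr_ge0.
rewrite integral_onem_gauss ?divr_ge0 ?euclid_norm_ge0// -EFinM; congr EFin.
by rewrite exprSr; field.
Qed.

Lemma cst_cE n : cst_c n = Num.sqrt pi ^+ n.+1 / fine (@egamma_half R n).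
Proof.
rewrite /cst_c; congr (_ / _).
by rewrite -nat1r mulrC powRrM powR12_sqrt ?pi_ge0// nat1r powR_mulrn// sqrtr_ge0.
Qed.

(** For x <> 0 the product in [egamma_half_cosine] is a positive real number,
    which forces each of its two nonnegative factors to be finite and positive.
    A nonzero x exists because the dimension is positive. *)
Lemma egamma_half_gt0 n : 0 < fine (@egamma_half R n.+1) /\
  @egamma_half R n.+1 = (fine (@egamma_half R n.+1))%:E.
Proof.
(* any vector of positive norm will do *)
pose x : n.+1.-tuple R := [tuple 1 | i < n.+1].
have x0 : 0 < euclid_norm x.
  rewrite sqrtr_gt0 /euclid_dot (eq_bigr (fun=> 1)).
    by rewrite sumr_const card_ord ltr0n.
  by move=> i _; rewrite tnth_mktuple mulr1.
have := egamma_half_cosine x.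
set I := (X in (_ * X)%E); set r := (X in X%:E).
have r0 : 0 < r by rewrite mulr_gt0// exprn_gt0// sqrtr_gt0 pi_gt0.
have I0 : (0 <= I)%E.
  apply: integral_ge0 => t _.
  by rewrite lee_fin divr_ge0 ?subr_ge0 ?cos_le1 ?exprn_ge0 ?euclid_norm_ge0//.
have e0 : (0 <= @egamma_half R n.+1)%E.
  by apply: integral_ge0 => t _; rewrite lee_fin mulr_ge0 ?powR_ge0 ?expR_ge0.
case: (egamma_half n.+1) e0 => [e| |]//= e0.
  move=> H; split=> //; rewrite lt_neqAle -lee_fin e0 andbT.
  by apply/eqP => e00; move: H; rewrite -e00 mul0e => -[] /eqP; rewrite lt_eqF.
move: I0; rewrite le_eqVlt => /predU1P[<-|I0].
  by rewrite mule0 => -[] /eqP; rewrite lt_eqF.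
by rewrite gt0_mulye.
Qed.

Lemma cst_c_gt0 n : 0 < cst_c n.+1 :> R.
Proof.
rewrite cst_cE divr_gt0//; last by have [] := egamma_half_gt0 n.
by rewrite exprn_gt0// sqrtr_gt0 pi_gt0.
Qed.

(** The defining property of the constants c_n: the Euclidean distance is a
    superposition of the functions 1 - cos <t, x - y>. *)
Lemma integral_cosine_kernel n (x : n.-tuple R) :
  (\int[lebesgue_tuple n]_t
     ((1 - cos (euclid_dot t x)) / euclid_norm t ^+ n.+1)%:E =
   (cst_c n * euclid_norm x)%:E)%E.
Proof.
case: n x => [|n] x.
  have d0 (t y : 0.-tuple R) : euclid_dot t y = 0 by rewrite /euclid_dot big_ord0.
  rewrite [euclid_norm x](_ : _ = 0); last by rewrite /euclid_norm d0 sqrtr0.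
  rewrite mulr0 integral0_eq// => t _.
  by rewrite d0 cos0 subrr mul0r.
have := egamma_half_cosine x; have [g0 ->] := egamma_half_gt0 n.
set I := (X in (_ * X)%E) => H.
rewrite cst_cE mulrAC mulrC EFinM -H muleA -EFinM mulVf ?mul1e//.
by rewrite gt_eqF.
Qed.

End cosine_kernel.

(** * Squared means as double integrals of kernels *)

Section product_sigma_finite.
Context dA dB (A : measurableType dA) (B : measurableType dB) (R : realType).
Variables (alpha : {sigma_finite_measure set A -> \bar R}).
Variables (beta : {sigma_finite_measure set B -> \bar R}).

(** Bundles a product measure with its sigma-finiteness, so that it can itself
    be a factor in Fubini's theorem. *)
Definition sigma_finite_prod : {sigma_finite_measure set (A * B)%type -> \bar R} :=
  HB.pack (alpha \x beta)%E
    (lebesgue_integral_fubini.measure_function_Measure_isSigmaFinite__to__measure_function_isSFinite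
       alpha beta)
    (lebesgue_integral_fubini.measure_function_Measure_isSigmaFinite__to__measure_function_isSigmaFinite
       alpha beta).

End product_sigma_finite.

Section integral_of_products.
Context d1 d2 (T1 : measurableType d1) (T2 : measurableType d2) (R : realType).
Variable m1 : {sigma_finite_measure set T1 -> \bar R}.
Variable m2 : {sigma_finite_measure set T2 -> \bar R}.

Lemma ge0_integral_prodM (f : T1 -> \bar R) (g : T2 -> \bar R) :
  measurable_fun setT f -> measurable_fun setT g ->
  (forall x, (0 <= f x)%E) -> (forall y, (0 <= g y)%E) ->
  (\int[m1 \x m2]_p (f p.1 * g p.2) = \int[m1]_x f x * \int[m2]_y g y)%E.
Proof.
move=> mf mg f0 g0; rewrite fubini_tonelli1; last 2 first.
- apply: emeasurable_funM.
    exact: measurableT_comp mf measurable_fst.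
  exact: measurableT_comp mg measurable_snd.
- by move=> p; rewrite mule_ge0.
rewrite /fubini_F/=.
under eq_integral do rewrite ge0_integralZl//.
by rewrite ge0_integralZr//; exact: integral_ge0.
Qed.

Lemma integrable_prodM (f : T1 -> R) (g : T2 -> R) :
  m1.-integrable setT (EFin \o f) -> m2.-integrable setT (EFin \o g) ->
  (m1 \x m2)%E.-integrable setT (fun p => (f p.1 * g p.2)%:E).
Proof.
move=> /integrableP[mf fi] /integrableP[mg gi].
apply/integrableP; split.
  apply/measurable_EFinP; apply: measurable_funM.
    exact: measurableT_comp ((measurable_EFinP _ _).1 mf) measurable_fst.
  exact: measurableT_comp ((measurable_EFinP _ _).1 mg) measurable_snd.
under eq_integral do rewrite abse_EFin normrM EFinM.
rewrite (ge0_integral_prodM (f := fun x => `|f x|%:E) (g := fun y => `|g y|%:E))//; last 2 first.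
- exact: (measurableT_comp (@abse_measurable _ _) mf).
- exact: (measurableT_comp (@abse_measurable _ _) mg).
by rewrite lte_mul_pinfty// ?ge0_fin_numE//; apply: integral_ge0.
Qed.

Lemma integral_prodM (f : T1 -> R) (g : T2 -> R) :
  m1.-integrable setT (EFin \o f) -> m2.-integrable setT (EFin \o g) ->
  (\int[m1 \x m2]_p (f p.1 * g p.2)%:E =
   ((\int[m1]_x f x) * (\int[m2]_y g y))%:E)%E.
Proof.
move=> fi gi; rewrite -integral12_prod_meas1/=; last exact: integrable_prodM.
rewrite /fubini_F/=.
under eq_integral => x _.
  under eq_integral do rewrite EFinM.
  rewrite integralZl// -(fineK (integrable_fin_num _ gi))//.
  over.
rewrite integralZr// -(fineK (integrable_fin_num _ fi))//.
Qed.

End integral_of_products.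

Lemma integrable_mul_sqr d (T : measurableType d) (R : realType)
    (m : {measure set T -> \bar R}) (f g : T -> R) :
  measurable_fun setT f -> measurable_fun setT g ->
  (\int[m]_t (f t ^+ 2)%:E < +oo)%E -> (\int[m]_t (g t ^+ 2)%:E < +oo)%E ->
  m.-integrable setT (fun t => (f t * g t)%:E).
Proof.
have sq (k : T -> R) : measurable_fun setT k -> (\int[m]_t (k t ^+ 2)%:E < +oo)%E ->
    m.-integrable setT (fun t => (k t ^+ 2)%:E).
  move=> mk ki; apply/integrableP; split.
    by apply/measurable_EFinP; exact: measurable_funX.
  by under eq_integral do rewrite gee0_abs ?lee_fin ?sqr_ge0//.
move=> mf mg fi gi.
apply: (le_integrable _ _ _ (integrableD measurableT (sq _ mf fi) (sq _ mg gi))) => //.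
  by apply/measurable_EFinP; exact: measurable_funM.
move=> t _; rewrite /= lee_fin [X in _ <= X]ger0_norm ?addr_ge0 ?sqr_ge0//.
rewrite ler_norml; apply/andP; split; rewrite -subr_ge0.
  rewrite (_ : _ - _ = ((f t + g t) ^+ 2 + (f t) ^+ 2 + (g t) ^+ 2) / 2); last by field.
  by rewrite divr_ge0// !addr_ge0// sqr_ge0.
rewrite (_ : _ - _ = ((f t - g t) ^+ 2 + (f t) ^+ 2 + (g t) ^+ 2) / 2); last by field.
by rewrite divr_ge0// !addr_ge0// sqr_ge0.
Qed.

Section squared_mean_kernel.
Context dA dB (A : measurableType dA) (B : measurableType dB).
Context d1 d2 (T1 : measurableType d1) (T2 : measurableType d2) (R : realType).
Variables (alpha : {sigma_finite_measure set A -> \bar R}).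
Variables (beta : {sigma_finite_measure set B -> \bar R}).
Variable theta : probability (T1 * T2)%type R.
Variables (u : A * T1 -> R) (v : B * T2 -> R).
Hypotheses (mu : measurable_fun setT u) (mv : measurable_fun setT v).
Hypothesis u2 : forall x, (\int[alpha]_t (u (t, x) ^+ 2)%:E < +oo)%E.
Hypothesis v2 : forall y, (\int[beta]_s (v (s, y) ^+ 2)%:E < +oo)%E.
Hypothesis Eu2 : (\int[theta]_p \int[alpha]_t (u (t, p.1) ^+ 2)%:E < +oo)%E.
Hypothesis Ev2 : (\int[theta]_p \int[beta]_s (v (s, p.2) ^+ 2)%:E < +oo)%E.
Hypothesis iuv : forall t s,
  theta.-integrable setT (fun p => (u (t, p.1) * v (s, p.2))%:E).

Let Ku x x' : R := \int[alpha]_t (u (t, x) * u (t, x')).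
Let Kv y y' : R := \int[beta]_s (v (s, y) * v (s, y')).
Let Q := ((T1 * T2) * (T1 * T2))%type.

Let h (w : Q * (A * B)) : R :=
  (u (w.2.1, w.1.1.1) * v (w.2.2, w.1.1.2)) *
  (u (w.2.1, w.1.2.1) * v (w.2.2, w.1.2.2)).

Let mh : measurable_fun setT (EFin \o h).
Proof.
apply/measurable_EFinP.
have m21 : measurable_fun setT (fun w : Q * (A * B) => w.2.1).
  by apply: (measurableT_comp measurable_fst).
have m22 : measurable_fun setT (fun w : Q * (A * B) => w.2.2).
  by apply: (measurableT_comp measurable_snd).
have m111 : measurable_fun setT (fun w : Q * (A * B) => w.1.1.1).
  by apply: (measurableT_comp measurable_fst); apply: (measurableT_comp measurable_fst).
have m112 : measurable_fun setT (fun w : Q * (A * B) => w.1.1.2).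
  by apply: (measurableT_comp measurable_snd); apply: (measurableT_comp measurable_fst).
have m121 : measurable_fun setT (fun w : Q * (A * B) => w.1.2.1).
  by apply: (measurableT_comp measurable_fst); apply: (measurableT_comp measurable_snd).
have m122 : measurable_fun setT (fun w : Q * (A * B) => w.1.2.2).
  by apply: (measurableT_comp measurable_snd); apply: (measurableT_comp measurable_snd).
apply: measurable_funM; apply: measurable_funM.
- by apply: (measurableT_comp mu); exact: measurable_fun_pair.
- by apply: (measurableT_comp mv); exact: measurable_fun_pair.
- by apply: (measurableT_comp mu); exact: measurable_fun_pair.
- by apply: (measurableT_comp mv); exact: measurable_fun_pair.
Qed.

Let U x : \bar R := (\int[alpha]_t (u (t, x) ^+ 2)%:E)%E.
Let V y : \bar R := (\int[beta]_s (v (s, y) ^+ 2)%:E)%E.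

Let mU : measurable_fun setT U.
Proof.
apply: (measurable_fun_fubini_tonelli_G (fun p : A * T1 => (u p ^+ 2)%:E)).
  by apply/measurable_EFinP; exact: measurable_funX.
by move=> p; rewrite lee_fin sqr_ge0.
Qed.

Let mV : measurable_fun setT V.
Proof.
apply: (measurable_fun_fubini_tonelli_G (fun p : B * T2 => (v p ^+ 2)%:E)).
  by apply/measurable_EFinP; exact: measurable_funX.
by move=> p; rewrite lee_fin sqr_ge0.
Qed.

Let U0 x : (0 <= U x)%E.
Proof. by apply: integral_ge0 => t _; rewrite lee_fin sqr_ge0. Qed.

Let V0 y : (0 <= V y)%E.
Proof. by apply: integral_ge0 => t _; rewrite lee_fin sqr_ge0. Qed.

Let mux x : measurable_fun setT (fun t => u (t, x)).
Proof. by apply: (measurableT_comp mu); exact: measurable_fun_pair. Qed.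

Let mvy y : measurable_fun setT (fun s => v (s, y)).
Proof. by apply: (measurableT_comp mv); exact: measurable_fun_pair. Qed.

Let prodUV x y : (\int[alpha \x beta]_p ((u (p.1, x) ^+ 2) * (v (p.2, y) ^+ 2))%:E =
  U x * V y)%E.
Proof.
under eq_integral do rewrite EFinM.
rewrite (ge0_integral_prodM alpha beta (f := fun t => (u (t, x) ^+ 2)%:E)
  (g := fun s => (v (s, y) ^+ 2)%:E))//.
- by apply/measurable_EFinP; exact: measurable_funX.
- by apply/measurable_EFinP; exact: measurable_funX.
- by move=> t; rewrite lee_fin sqr_ge0.
- by move=> t; rewrite lee_fin sqr_ge0.
Qed.

Let hle (p : A * B) (q : Q) : `|h (q, p)| <=
  (u (p.1, q.1.1) ^+ 2) * (v (p.2, q.2.2) ^+ 2) +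
  (u (p.1, q.2.1) ^+ 2) * (v (p.2, q.1.2) ^+ 2).
Proof.
rewrite /h/=; set a := u _; set b := v _; set c := u _; set d := v _.
rewrite -!exprMn ler_norml; apply/andP; split; rewrite -subr_ge0.
  (* 2 (X^2 + Y^2 + X Y) = (X + Y)^2 + X^2 + Y^2 with X = a d and Y = c b *)
  rewrite (_ : _ - _ = ((a * d + c * b) ^+ 2 + (a * d) ^+ 2 + (c * b) ^+ 2) / 2); last by field.
  by rewrite divr_ge0// !addr_ge0// sqr_ge0.
rewrite (_ : _ - _ = ((a * d - c * b) ^+ 2 + (a * d) ^+ 2 + (c * b) ^+ 2) / 2); last by field.
by rewrite divr_ge0// !addr_ge0// sqr_ge0.
Qed.

Let ab := sigma_finite_prod alpha beta.
Let tt := sigma_finite_prod theta theta.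

Let ih : (tt \x ab)%E.-integrable setT (EFin \o h).
Proof.
apply: (proj2 (integrable12ltyP tt ab mh)).
pose k (q : Q) := (U q.1.1 * V q.2.2 + V q.1.2 * U q.2.1)%E.
have mUf : measurable_fun setT (fun p : T1 * T2 => U p.1).
  exact: (measurableT_comp mU).
have mVs : measurable_fun setT (fun p : T1 * T2 => V p.2).
  exact: (measurableT_comp mV).
have mk1 : measurable_fun setT (fun q : Q => U q.1.1 * V q.2.2)%E.
  apply: emeasurable_funM.
    exact: (measurableT_comp mUf measurable_fst).
  exact: (measurableT_comp mVs measurable_snd).
have mk2 : measurable_fun setT (fun q : Q => V q.1.2 * U q.2.1)%E.
  apply: emeasurable_funM.
    exact: (measurableT_comp mVs measurable_fst).
  exact: (measurableT_comp mUf measurable_snd).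
apply: (@le_lt_trans _ _ (\int[theta \x theta]_q k q)%E).
  apply: ge0_le_integral => //.
  - by move=> q _; apply: integral_ge0.
  - apply: (measurable_fun_fubini_tonelli_F (abse \o (EFin \o h))) => //.
      exact: measurableT_comp.
    by move=> w; exact: abse_ge0.
  - exact: (emeasurable_funD mk1 mk2).
  - move=> q _; rewrite /k -prodUV (muleC (V _)) -prodUV -ge0_integralD//; last 4 first.
    + by move=> p _; rewrite lee_fin mulr_ge0// sqr_ge0.
    + apply/measurable_EFinP; apply: measurable_funM; apply: measurable_funX.
        exact: (measurableT_comp (mux _)).
      exact: (measurableT_comp (mvy _)).
    + by move=> p _; rewrite lee_fin mulr_ge0// sqr_ge0.
    + apply/measurable_EFinP; apply: measurable_funM; apply: measurable_funX.
        exact: (measurableT_comp (mux _)).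
      exact: (measurableT_comp (mvy _)).
    apply: ge0_le_integral => //.
    + apply: (measurableT_comp (@abse_measurable _ _)).
      apply: (measurableT_comp mh); exact: measurable_fun_pair.
    + apply: emeasurable_funD.
        apply/measurable_EFinP; apply: measurable_funM; apply: measurable_funX.
          exact: (measurableT_comp (mux _)).
        exact: (measurableT_comp (mvy _)).
      apply/measurable_EFinP; apply: measurable_funM; apply: measurable_funX.
        exact: (measurableT_comp (mux _)).
      exact: (measurableT_comp (mvy _)).
    + by move=> p _; rewrite -EFinD lee_fin hle.
rewrite /k ge0_integralD//; last 2 first.
- by move=> q _; rewrite mule_ge0.
- by move=> q _; rewrite mule_ge0.
rewrite (ge0_integral_prodM theta theta (f := fun p => U p.1) (g := fun p => V p.2))//.
rewrite (ge0_integral_prodM theta theta (f := fun p => V p.2) (g := fun p => U p.1))//.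
have eU : (0 <= \int[theta]_p U p.1)%E by apply: integral_ge0.
have eV : (0 <= \int[theta]_p V p.2)%E by apply: integral_ge0.
by rewrite lte_add_pinfty// lte_mul_pinfty// ge0_fin_numE.
Qed.

Let iuu x x' : alpha.-integrable setT (fun t => (u (t, x) * u (t, x'))%:E).
Proof. exact: integrable_mul_sqr. Qed.

Let ivv y y' : beta.-integrable setT (fun s => (v (s, y) * v (s, y'))%:E).
Proof. exact: integrable_mul_sqr. Qed.

Let inner (q : Q) : (\int[alpha \x beta]_p (h (q, p))%:E =
  (Ku q.1.1 q.2.1 * Kv q.1.2 q.2.2)%:E)%E.
Proof.
rewrite -(integral_prodM (iuu _ _) (ivv _ _)).
by apply: eq_integral => p _; rewrite /h/= mulrACA.
Qed.

Let inner' (p : A * B) : (\int[theta \x theta]_q (h (q, p))%:E =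
  ((\int[theta]_q (u (p.1, q.1) * v (p.2, q.2))) ^+ 2)%:E)%E.
Proof.
rewrite expr2 -(integral_prodM (iuv _ _) (iuv _ _)).
by apply: eq_integral => q _.
Qed.

Lemma integrable_kernel_prod : (theta \x theta)%E.-integrable setT
  (fun q => (Ku q.1.1 q.2.1 * Kv q.1.2 q.2.2)%:E).
Proof.
have := integrable_fubini_F ih; apply: eq_integrable => // q _.
exact: inner.
Qed.

(** A squared mean is the double mean over two independent copies, so the
    left-hand side is a fourfold integral, and for fixed sample points the
    integral over the parameters factorises into the two kernels. Fubini's theorem
    applies because |u u' v v'| <= u^2 v'^2 + u'^2 v^2, where the two factors
    of each term depend on different, hence independent, copies. *)
Lemma integral_sqr_mean :
  (\int[alpha \x beta]_p
     ((\int[theta]_q (u (p.1, q.1) * v (p.2, q.2))) ^+ 2)%:E =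
   \int[theta \x theta]_q (Ku q.1.1 q.2.1 * Kv q.1.2 q.2.2)%:E)%E.
Proof.
transitivity (\int[alpha \x beta]_p \int[theta \x theta]_q (h (q, p))%:E)%E.
  by apply: eq_integral => p _; rewrite inner'.
rewrite -(Fubini ih); apply: eq_integral => q _; exact: inner.
Qed.

End squared_mean_kernel.

(** * Reflections of R^n and means of bounded functions *)

Section reflection.
Context {R : realType}.
Notation mu := (@lebesgue_measure R).

Definition tuple_opp n (x : n.-tuple R) : n.-tuple R := [tuple - tnth x i | i < n].

Lemma tuple_opp_cons n (a : R) (y : n.-tuple R) :
  tuple_opp [tuple of a :: y] = [tuple of - a :: tuple_opp y].
Proof.
apply: eq_from_tnth => i; rewrite tnth_mktuple.
by case: (unliftP ord0 i) => [j ->|->]; rewrite ?tnthS ?tnth_mktuple.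
Qed.

Lemma measurable_tuple_opp n : measurable_fun setT (@tuple_opp n).
Proof.
apply/measurable_fun_tnthP => i.
rewrite (_ : _ \o _ = (fun x : n.-tuple R => - tnth x i)).
  by apply: measurableT_comp => //; exact: measurable_tnth.
by apply/funext => x; rewrite /= tnth_mktuple.
Qed.

Lemma euclid_dot_oppl n (x y : n.-tuple R) : euclid_dot (tuple_opp x) y = - euclid_dot x y.
Proof.
by rewrite /euclid_dot -sumrN; apply: eq_bigr => i _; rewrite tnth_mktuple mulNr.
Qed.

Lemma euclid_norm_opp n (x : n.-tuple R) : euclid_norm (tuple_opp x) = euclid_norm x.
Proof.
congr Num.sqrt; apply: eq_bigr => i _; rewrite tnth_mktuple mulrNN//.
Qed.

Lemma ge0_integral_tuple_opp n (f : n.-tuple R -> \bar R) :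
  measurable_fun setT f -> (forall x, (0 <= f x)%E) ->
  (\int[lebesgue_tuple n]_x f (tuple_opp x) = \int[lebesgue_tuple n]_x f x)%E.
Proof.
elim: n f => [|n IH] f mf f0.
  by apply: eq_integral => x _; congr f; apply: eq_from_tnth => -[].
have mfo := measurableT_comp mf (@measurable_tuple_opp n.+1).
rewrite (ge0_integral_lebesgue_tupleS mfo (fun x => f0 (tuple_opp x)))/=.
have mc (a : R) : measurable_fun setT (fun y : n.-tuple R => f [tuple of a :: y]).
  by apply: (measurableT_comp mf); exact: measurable_cons.
under eq_integral => a _.
  under eq_integral do rewrite tuple_opp_cons.
  rewrite (IH (fun y => f [tuple of - a :: y]))//.
  over.
rewrite [RHS](ge0_integral_lebesgue_tupleS mf f0).
rewrite (@ge0_integral_opp R (fun a => \int[lebesgue_tuple n]_y f [tuple of a :: y])%E)//.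
  apply: (measurable_fun_fubini_tonelli_F (m2 := lebesgue_tuple n) (f \o (@tuple_cons R n))) => //.
    exact: (measurableT_comp mf (@measurable_tuple_cons R n)).
  by move=> p; exact: f0.
by move=> a; apply: integral_ge0.
Qed.

End reflection.

Section bounded_means.
Context {R : realType}.

(** Indexing cosine and sine by a boolean treats the real and imaginary
    parts of exp (i a) uniformly. *)
Definition trig (b : bool) : R -> R := if b then @cos R else @sin R.

Lemma measurable_trig b : measurable_fun setT (trig b).
Proof. by case: b; [exact: measurable_cos|exact: measurable_sin]. Qed.

Lemma norm_trig_le1 b a : `|trig b a| <= 1.
Proof.
by rewrite ler_norml; case: b; rewrite ?cos_geN1 ?cos_le1 ?sin_geN1 ?sin_le1.
Qed.

Lemma trig_opp b a : trig b (- a) = (-1) ^+ (~~ b) * trig b a.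
Proof. by case: b; rewrite /= ?cosN ?sinN ?expr0 ?expr1 ?mul1r ?mulN1r. Qed.

Context d (T : measurableType d) (P : probability T R).

Lemma integrable_bounded (f : T -> R) : measurable_fun setT f ->
  (forall x, `|f x| <= 1) -> P.-integrable setT (EFin \o f).
Proof.
move=> mf f1.
apply: (le_integrable _ _ _ (finite_measure_integrable_cst P 1 measurableT)) => //.
  exact/measurable_EFinP.
by move=> x _; rewrite /= lee_fin normr1.
Qed.

Lemma Rintegral1 : \int[P]_x 1 = 1 :> R.
Proof. by rewrite Rintegral_cst//= probability_setT/= mulr1. Qed.

(** Tonelli's theorem gives this for the nonnegative function 1 - f; Fubini's
    theorem is not available, as the parameter space carries no finite
    measure. *)
Lemma measurable_bounded_mean d' (A : measurableType d') (f : A * T -> R) :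
  measurable_fun setT f -> (forall p, `|f p| <= 1) ->
  measurable_fun setT (fun a => \int[P]_x f (a, x)).
Proof.
move=> mf f1.
have -> : (fun a => \int[P]_x f (a, x)) =
    (fun a => 1 - fine (fubini_F P (fun p => (1 - f p)%:E) a)).
  apply/funext => a; rewrite /fubini_F/= -/(Rintegral _ _ _).
  have i0 := finite_measure_integrable_cst P (1 : R) measurableT.
  have i1 : P.-integrable setT (EFin \o (fun x => f (a, x))).
    apply: integrable_bounded => //.
    by apply: (measurableT_comp mf); exact: measurable_fun_pair.
  by rewrite RintegralB// Rintegral1 subKr.
apply: measurable_funB => //; apply: measurableT_comp => //.
apply: measurable_fun_fubini_tonelli_F.
  by apply/measurable_EFinP; apply: measurable_funB.
by move=> p; rewrite lee_fin subr_ge0 (le_trans (ler_norm _)).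
Qed.

End bounded_means.

(** * Centred exponentials and the doubly centred distance *)

Section one_marginal.
Context {R : realType} {n : nat}.
Variable rho : probability (n.-tuple R) R.
Hypothesis hrho : finite_first_moment rho.
Notation T := (n.-tuple R).
Notation lam := (@lebesgue_tuple R n).

Let w (t : T) : R := (euclid_norm t ^+ n.+1)^-1.
Let w0 t : 0 <= w t. Proof. by rewrite invr_ge0 exprn_ge0// euclid_norm_ge0. Qed.

Definition mean_trig b (t : T) : R := \int[rho]_x trig b (euclid_dot t x).

(** The real (b = true) and imaginary (b = false) parts of the centred
    exponential exp (i <t, x>) - E exp (i <t, X>), with the square root of the
    weight 1 / |t|^(n+1) absorbed. *)
Definition wtrig b (p : T * T) : R :=
  Num.sqrt (w p.1) * (trig b (euclid_dot p.1 p.2) - mean_trig b p.1).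

Definition tuple_sub (x y : T) : T := [tuple tnth x i - tnth y i | i < n].

Lemma euclid_dot_sub (t x y : T) :
  euclid_dot t (tuple_sub x y) = euclid_dot t x - euclid_dot t y.
Proof.
rewrite /euclid_dot -sumrB; apply: eq_bigr => i _.
by rewrite tnth_mktuple mulrBr.
Qed.

Lemma measurable_tuple_sub d (S : measurableType d) (f g : S -> T) :
  measurable_fun setT f -> measurable_fun setT g ->
  measurable_fun setT (fun x => tuple_sub (f x) (g x)).
Proof.
move=> mf mg; apply/measurable_fun_tnthP => i.
rewrite (_ : _ \o _ = (fun x => tnth (f x) i - tnth (g x) i)).
  apply: measurable_funB.
    by apply: (measurableT_comp (measurable_tnth i)).
  by apply: (measurableT_comp (measurable_tnth i)).
by apply/funext => x; rewrite /= tnth_mktuple.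
Qed.

Lemma measurable_euclid_dist d (S : measurableType d) (f g : S -> T) :
  measurable_fun setT f -> measurable_fun setT g ->
  measurable_fun setT (fun x => euclid_dist (f x) (g x)).
Proof.
by move=> mf mg; apply: measurable_euclid_norm; exact: measurable_tuple_sub.
Qed.

(** A crude form of the triangle inequality, enough for integrability. *)
Lemma euclid_dist_le (x y : T) :
  euclid_dist x y <= 2 * (euclid_norm x + euclid_norm y).
Proof.
have h0 : 0 <= 2 * (euclid_norm x + euclid_norm y).
  by rewrite mulr_ge0// addr_ge0// euclid_norm_ge0.
rewrite -(@ler_pXn2r _ 2)// ?nnegrE ?euclid_norm_ge0//.
rewrite sqr_euclid_norm exprMn.
apply: (@le_trans _ _ (2 * euclid_norm x ^+ 2 + 2 * euclid_norm y ^+ 2)).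
  rewrite !sqr_euclid_norm /euclid_dot !mulr_sumr -big_split/=.
  apply: ler_sum => i _; rewrite tnth_mktuple -subr_ge0.
  rewrite (_ : _ - _ = (tnth x i + tnth y i) ^+ 2) ?sqr_ge0//; ring.
have x0 := euclid_norm_ge0 x; have y0 := euclid_norm_ge0 y.
nra.
Qed.

Lemma euclid_dist_ge0 (x y : T) : 0 <= euclid_dist x y.
Proof. exact: euclid_norm_ge0. Qed.

Lemma integrable_euclid_norm : rho.-integrable setT (EFin \o @euclid_norm R n).
Proof.
apply/integrableP; split.
  by apply/measurable_EFinP; exact: measurable_euclid_norm.
under eq_integral do rewrite gee0_abs ?lee_fin ?euclid_norm_ge0//.
exact: hrho.
Qed.

Lemma integrable_euclid_dist (x : T) :
  rho.-integrable setT (fun y => (euclid_dist x y)%:E).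
Proof.
have i1 := integrableZl measurableT 2 (integrableD measurableT
  (finite_measure_integrable_cst rho (euclid_norm x) measurableT) integrable_euclid_norm).
apply: (le_integrable _ _ _ i1) => //.
  by apply/measurable_EFinP; exact: measurable_euclid_dist.
move=> y _; rewrite /= lee_fin !ger0_norm ?euclid_dist_le ?euclid_dist_ge0//.
by rewrite mulr_ge0// addr_ge0// euclid_norm_ge0.
Qed.

Lemma mean_distE (x : T) :
  (\int[rho]_y (euclid_dist x y)%:E = (mean_dist euclid_dist rho x)%:E)%E.
Proof. by rewrite -(fineK (integrable_fin_num _ (integrable_euclid_dist x))). Qed.

Lemma mean_dist_ge0 x : 0 <= mean_dist euclid_dist rho x.
Proof. by apply: Rintegral_ge0 => y _; exact: euclid_dist_ge0. Qed.

Lemma measurable_mean_dist : measurable_fun setT (mean_dist euclid_dist rho).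
Proof.
apply/measurable_EFinP.
have -> : EFin \o mean_dist euclid_dist rho =
    fubini_F rho (fun p : T * T => (euclid_dist p.1 p.2)%:E).
  by apply/funext => x; rewrite /= -mean_distE.
apply: measurable_fun_fubini_tonelli_F.
  by apply/measurable_EFinP; apply: measurable_euclid_dist.
by move=> p; rewrite lee_fin euclid_dist_ge0.
Qed.

Lemma mean_dist_le x : mean_dist euclid_dist rho x <=
  2 * (euclid_norm x + \int[rho]_y euclid_norm y).
Proof.
have i0 := finite_measure_integrable_cst rho (euclid_norm x) measurableT.
have i1 := integrableD measurableT i0 integrable_euclid_norm.
have i2 := integrableZl measurableT 2 i1.
have -> : 2 * (euclid_norm x + \int[rho]_y euclid_norm y) =
    \int[rho]_y (2 * (euclid_norm x + euclid_norm y)).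
  rewrite RintegralZl// RintegralD//; last exact: integrable_euclid_norm.
  by rewrite Rintegral_cst//= probability_setT/= mulr1.
apply: le_Rintegral => //; first exact: integrable_euclid_dist.
by move=> y _; exact: euclid_dist_le.
Qed.

Lemma integrable_mean_dist :
  rho.-integrable setT (EFin \o mean_dist euclid_dist rho).
Proof.
set e := \int[rho]_y euclid_norm y.
have i0 := finite_measure_integrable_cst rho e measurableT.
have i2 := integrableZl measurableT 2 (integrableD measurableT integrable_euclid_norm i0).
apply: (le_integrable _ _ _ i2) => //.
  by apply/measurable_EFinP; exact: measurable_mean_dist.
move=> x _; rewrite /= lee_fin [X in X <= _]ger0_norm ?mean_dist_ge0//.
by rewrite (le_trans (mean_dist_le x))// ler_norm.
Qed.

Lemma total_mean_distE :
  (\int[rho]_x (mean_dist euclid_dist rho x)%:E = (total_mean_dist euclid_dist rho)%:E)%E.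
Proof. by rewrite -(fineK (integrable_fin_num _ integrable_mean_dist)). Qed.

Lemma measurable_trig_dot b d (S : measurableType d) (f g : S -> T) :
  measurable_fun setT f -> measurable_fun setT g ->
  measurable_fun setT (fun x => trig b (euclid_dot (f x) (g x))).
Proof.
move=> mf mg; apply: (measurableT_comp (measurable_trig b)).
exact: measurable_euclid_dot.
Qed.

Lemma integrable_trig_dot b t :
  rho.-integrable setT (fun x => (trig b (euclid_dot t x))%:E).
Proof.
apply: integrable_bounded => [|x]; last exact: norm_trig_le1.
exact: measurable_trig_dot.
Qed.

Lemma measurable_mean_trig b : measurable_fun setT (mean_trig b).
Proof.
apply: (@measurable_bounded_mean R _ _ rho _ _ (fun p : T * T => trig b (euclid_dot p.1 p.2))).
  exact: measurable_trig_dot.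
by move=> p; exact: norm_trig_le1.
Qed.

Let mw : measurable_fun setT w.
Proof. by apply: measurable_expVn; exact: measurable_euclid_norm. Qed.

Let msw : measurable_fun setT (fun p : T * T => Num.sqrt (w p.1)).
Proof.
apply: (measurableT_comp (continuous_measurable_fun (@sqrt_continuous R))).
exact: (measurableT_comp mw measurable_fst).
Qed.

Lemma measurable_wtrig b : measurable_fun setT (wtrig b).
Proof.
apply: measurable_funM; first exact: msw.
apply: measurable_funB; first exact: measurable_trig_dot.
exact: (measurableT_comp (measurable_mean_trig b) measurable_fst).
Qed.

(** The mean of 1 - cos <t, x - X>, and below it the mean of the same
    quantity when x is random as well. *)
Let gap (t x : T) : R :=
  1 - (mean_trig true t * cos (euclid_dot t x) + mean_trig false t * sin (euclid_dot t x)).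
Let ggap (t : T) : R := 1 - (mean_trig true t ^+ 2 + mean_trig false t ^+ 2).

Let gapE (t x : T) :
  (\int[rho]_y (1 - cos (euclid_dot t (tuple_sub x y)))%:E = (gap t x)%:E)%E.
Proof.
have i0 := finite_measure_integrable_cst rho (1 : R) measurableT.
have i1 := integrableZl measurableT (cos (euclid_dot t x)) (integrable_trig_dot true t).
have i2 := integrableZl measurableT (sin (euclid_dot t x)) (integrable_trig_dot false t).
have i3 := integrableD measurableT i1 i2.
have i4 := integrableB measurableT i0 i3.
have E : (fun y => (1 - cos (euclid_dot t (tuple_sub x y)))%:E) =
   EFin \o (fun y => 1 - (cos (euclid_dot t x) * cos (euclid_dot t y) +
     sin (euclid_dot t x) * sin (euclid_dot t y))).
  by apply/funext => y; rewrite /= euclid_dot_sub cosB.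
rewrite E -(fineK (integrable_fin_num _ i4))//; congr EFin.
rewrite -/(Rintegral _ _ _) RintegralB// Rintegral1; congr (_ - _).
rewrite RintegralD// RintegralZl//; last exact: (integrable_trig_dot true).
rewrite RintegralZl//; last exact: (integrable_trig_dot false).
by rewrite mulrC [X in _ + X]mulrC.
Qed.

Let ggapE (t : T) : (\int[rho]_x (gap t x)%:E = (ggap t)%:E)%E.
Proof.
have i0 := finite_measure_integrable_cst rho (1 : R) measurableT.
have i1 := integrableZl measurableT (mean_trig true t) (integrable_trig_dot true t).
have i2 := integrableZl measurableT (mean_trig false t) (integrable_trig_dot false t).
have i3 := integrableD measurableT i1 i2.
have i4 := integrableB measurableT i0 i3.
rewrite -(fineK (integrable_fin_num _ i4))//; congr EFin.
rewrite -/(Rintegral _ _ _) RintegralB// Rintegral1; congr (_ - _).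
rewrite RintegralD// RintegralZl//; last exact: (integrable_trig_dot true).
rewrite RintegralZl//; last exact: (integrable_trig_dot false).
Qed.

Let c0 (a : R) : 0 <= 1 - cos a. Proof. by rewrite subr_ge0 cos_le1. Qed.

Let gap0 t x : 0 <= gap t x.
Proof. by rewrite -lee_fin -gapE; apply: integral_ge0 => y _; rewrite lee_fin. Qed.

Let ggap0 t : 0 <= ggap t.
Proof. by rewrite -lee_fin -ggapE; apply: integral_ge0 => y _; rewrite lee_fin. Qed.

Let mgap : measurable_fun setT (fun p : T * T => gap p.1 p.2).
Proof.
apply: measurable_funB => //; apply: measurable_funD; apply: measurable_funM.
- exact: (measurableT_comp (measurable_mean_trig true) measurable_fst).
- exact: (@measurable_trig_dot true).
- exact: (measurableT_comp (measurable_mean_trig false) measurable_fst).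
- exact: (@measurable_trig_dot false).
Qed.

Let mpl (t : T) : measurable_fun setT (fun y : T => (t, y)).
Proof. exact: measurable_fun_pair. Qed.

Let mpr (y : T) : measurable_fun setT (fun t : T => (t, y)).
Proof. exact: measurable_fun_pair. Qed.

(** By Tonelli's theorem this is the mean of [integral_cosine_kernel] at
    the random points x - X. *)
Let int_gap (x : T) : (\int[lam]_t (w t * gap t x)%:E =
  (cst_c n * mean_dist euclid_dist rho x)%:E)%E.
Proof.
pose f (p : T * T) := (w p.1 * (1 - cos (euclid_dot p.1 (tuple_sub x p.2))))%:E.
have mc : measurable_fun setT (fun p : T * T => 1 - cos (euclid_dot p.1 (tuple_sub x p.2))).
  apply: measurable_funB => //; apply: (measurableT_comp measurable_cos).
  by apply: measurable_euclid_dot => //; exact: measurable_tuple_sub.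
transitivity (\int[lam]_t \int[rho]_y f (t, y))%E.
  apply: eq_integral => t _; rewrite EFinM -gapE -ge0_integralZl//.
  - apply/measurable_EFinP; exact: (measurableT_comp mc (mpl t)).
  - by rewrite lee_fin.
rewrite fubini_tonelli//; last 2 first.
- apply/measurable_EFinP; apply: measurable_funM => //.
  exact: (measurableT_comp mw measurable_fst).
- by move=> p; rewrite lee_fin mulr_ge0.
transitivity (\int[rho]_y ((cst_c n)%:E * (euclid_dist x y)%:E))%E.
  apply: eq_integral => y _; rewrite -EFinM -integral_cosine_kernel.
  by apply: eq_integral => t _; rewrite /f/= mulrC.
by rewrite integralZl// ?mean_distE ?EFinM//; exact: integrable_euclid_dist.
Qed.

Let int_ggap : (\int[lam]_t (w t * ggap t)%:E =
  (cst_c n * total_mean_dist euclid_dist rho)%:E)%E.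
Proof.
pose f (p : T * T) := (w p.1 * gap p.1 p.2)%:E.
transitivity (\int[lam]_t \int[rho]_y f (t, y))%E.
  apply: eq_integral => t _; rewrite EFinM -ggapE -ge0_integralZl//.
  - apply/measurable_EFinP; exact: (measurableT_comp mgap (mpl t)).
  - by move=> y _; rewrite lee_fin.
  - by rewrite lee_fin.
rewrite fubini_tonelli//; last 2 first.
- apply/measurable_EFinP; apply: measurable_funM => //.
  exact: (measurableT_comp mw measurable_fst).
- by move=> p; rewrite lee_fin mulr_ge0.
under eq_integral do rewrite /f/= int_gap EFinM.
by rewrite integralZl// ?total_mean_distE ?EFinM//; exact: integrable_mean_dist.
Qed.

(** The real part of the product of one centred exponential with the
    conjugate of the other, with every cosine replaced by 1 - cos: the four
    constants cancel, and each term becomes integrable. *)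
Lemma wtrig_mul t x x' :
  wtrig true (t, x) * wtrig true (t, x') + wtrig false (t, x) * wtrig false (t, x') =
  w t * gap t x + w t * gap t x' -
  w t * (1 - cos (euclid_dot t (tuple_sub x x'))) - w t * ggap t.
Proof.
rewrite euclid_dot_sub cosB /wtrig /gap /ggap/=.
have : Num.sqrt (w t) ^+ 2 = w t by rewrite sqr_sqrtr.
by move: (Num.sqrt (w t)) => r <-; ring.
Qed.

Lemma sqr_wtrig_le t x : wtrig true (t, x) ^+ 2 + wtrig false (t, x) ^+ 2 <= 2 * (w t * gap t x).
Proof.
rewrite !expr2 wtrig_mul euclid_dot_sub subrr cos0 subrr mulr0 subr0 mulr_natl mulr2n.
by rewrite gerBl mulr_ge0.
Qed.

Let mwgap x : measurable_fun setT (fun t => w t * gap t x).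
Proof.
apply: measurable_funM => //; exact: (measurableT_comp mgap (mpr x)).
Qed.

Lemma integral_sqr_wtrig_le b x : (\int[lam]_t (wtrig b (t, x) ^+ 2)%:E <=
  (2 * (cst_c n * mean_dist euclid_dist rho x))%:E)%E.
Proof.
rewrite EFinM -int_gap -ge0_integralZl//; last 2 first.
- exact/measurable_EFinP.
- by move=> t _; rewrite lee_fin mulr_ge0.
apply: ge0_le_integral => //.
- by move=> t _; rewrite lee_fin sqr_ge0.
- apply/measurable_EFinP; apply: measurable_funX.
  exact: (measurableT_comp (measurable_wtrig b) (mpr x)).
- by apply: measurable_funeM; exact/measurable_EFinP.
- move=> t _; rewrite -EFinM lee_fin; apply: le_trans (sqr_wtrig_le t x).
  by case: b; rewrite ?lerDl ?lerDr sqr_ge0.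
Qed.

Lemma measurable_integral_sqr_wtrig b :
  measurable_fun setT (fun x => \int[lam]_t (wtrig b (t, x) ^+ 2)%:E)%E.
Proof.
apply: (measurable_fun_fubini_tonelli_G (fun p : T * T => (wtrig b p ^+ 2)%:E)).
  by apply/measurable_EFinP; apply: measurable_funX; exact: measurable_wtrig.
by move=> p; rewrite lee_fin sqr_ge0.
Qed.

Lemma mean_integral_sqr_wtrig_lty b :
  (\int[rho]_x \int[lam]_t (wtrig b (t, x) ^+ 2)%:E < +oo)%E.
Proof.
have i1 := integrableZl measurableT (2 * cst_c n) integrable_mean_dist.
apply: (le_lt_trans _ (integrable_lty measurableT i1)).
apply: ge0_le_integral => //.
- by move=> x _; apply: integral_ge0 => t _; rewrite lee_fin sqr_ge0.
- exact: measurable_integral_sqr_wtrig.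
- exact: measurable_int i1.
- move=> x _; rewrite (le_trans (integral_sqr_wtrig_le b x))//.
  by rewrite /= mulrA lexx.
Qed.

(** Integrating [wtrig_mul] term by term with [integral_cosine_kernel] turns
    1 - cos into c_n times the distance, hence the mean of 1 - cos into c_n times
    the mean distance, and so on: the centred distance appears up to sign. *)
Lemma kernel_sum x x' :
  \int[lam]_t (wtrig true (t, x) * wtrig true (t, x')) +
  \int[lam]_t (wtrig false (t, x) * wtrig false (t, x')) =
  - (cst_c n * centered_dist euclid_dist rho x x').
Proof.
have mx (f : T * T -> R) y : measurable_fun setT f -> measurable_fun setT (fun t => f (t, y)).
  by move=> mf; exact: (measurableT_comp mf (mpr y)).
have ic : lam.-integrable setT (fun t => (wtrig true (t, x) * wtrig true (t, x'))%:E).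
  apply: integrable_mul_sqr; first exact: (mx _ _ (measurable_wtrig true)).
  - exact: (mx _ _ (measurable_wtrig true)).
  - exact: le_lt_trans (integral_sqr_wtrig_le true x) (ltry _).
  - exact: le_lt_trans (integral_sqr_wtrig_le true x') (ltry _).
have is_ : lam.-integrable setT (fun t => (wtrig false (t, x) * wtrig false (t, x'))%:E).
  apply: integrable_mul_sqr; first exact: (mx _ _ (measurable_wtrig false)).
  - exact: (mx _ _ (measurable_wtrig false)).
  - exact: le_lt_trans (integral_sqr_wtrig_le false x) (ltry _).
  - exact: le_lt_trans (integral_sqr_wtrig_le false x') (ltry _).
rewrite -RintegralD//.
under eq_Rintegral do rewrite wtrig_mul.
have ifin (f : T -> R) r : measurable_fun setT f -> (forall t, 0 <= f t) ->
    (\int[lam]_t (f t)%:E = r%:E)%E -> lam.-integrable setT (EFin \o f).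
  move=> mf f0 E; apply/integrableP; split; first exact/measurable_EFinP.
  by under eq_integral do rewrite gee0_abs ?lee_fin//; rewrite E ltry.
have mggap : measurable_fun setT ggap.
  apply: measurable_funB => //; apply: measurable_funD; apply: measurable_funX.
    exact: (measurable_mean_trig true).
  exact: (measurable_mean_trig false).
have ker : (\int[lam]_t (w t * (1 - cos (euclid_dot t (tuple_sub x x'))))%:E =
    (cst_c n * euclid_dist x x')%:E)%E.
  rewrite /euclid_dist -integral_cosine_kernel.
  by apply: eq_integral => t _; congr EFin; rewrite /w mulrC.
have i1 := ifin _ _ (mwgap x) (fun t => mulr_ge0 (w0 t) (gap0 t x)) (int_gap x).
have i2 := ifin _ _ (mwgap x') (fun t => mulr_ge0 (w0 t) (gap0 t x')) (int_gap x').
have i3 : lam.-integrable setT (EFin \o (fun t =>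
    w t * (1 - cos (euclid_dot t (tuple_sub x x'))))).
  apply: (ifin _ _ _ _ ker) => [|t]; last exact: mulr_ge0.
  apply: measurable_funM => //; apply: measurable_funB => //.
  by apply: (measurableT_comp measurable_cos); exact: measurable_euclid_dot.
have i4 := ifin _ _ (measurable_funM mw mggap) (fun t => mulr_ge0 (w0 t) (ggap0 t)) int_ggap.
have i12 := integrableD measurableT i1 i2.
have i123 := integrableB measurableT i12 i3.
rewrite RintegralB// RintegralB// RintegralD//.
rewrite /Rintegral int_gap int_gap ker int_ggap /= /centered_dist. ring.
Qed.

End one_marginal.

(** * From characteristic functions to distance covariance *)

Section four_terms.
Context d (T : measurableType d) (R : realType) (m : {measure set T -> \bar R}).

(** Symmetrisation: F' is a reflected copy of F with the same integral,
    and the average of F and F' is a sum of squares. *)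
Lemma integral_half_sum_sqr (F F' e1 e2 e3 e4 : T -> R) :
  measurable_fun setT F -> measurable_fun setT F' ->
  measurable_fun setT e1 -> measurable_fun setT e2 ->
  measurable_fun setT e3 -> measurable_fun setT e4 ->
  (forall x, 0 <= F x) -> (forall x, 0 <= F' x) ->
  (\int[m]_x (F' x)%:E = \int[m]_x (F x)%:E)%E ->
  (forall x, F x + F' x = 2 * (e1 x ^+ 2 + e2 x ^+ 2 + e3 x ^+ 2 + e4 x ^+ 2)) ->
  (\int[m]_x (F x)%:E = \int[m]_x (e1 x ^+ 2)%:E + \int[m]_x (e2 x ^+ 2)%:E +
    \int[m]_x (e3 x ^+ 2)%:E + \int[m]_x (e4 x ^+ 2)%:E)%E.
Proof.
move=> mF mF' m1 m2 m3 m4 F0 F'0 FF' FE.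
have s0 (e : T -> R) x : (0 <= (e x ^+ 2)%:E)%E by rewrite lee_fin sqr_ge0.
have ms (e : T -> R) : measurable_fun setT e -> measurable_fun setT (fun x => (e x ^+ 2)%:E).
  by move=> me; apply/measurable_EFinP; exact: measurable_funX.
have n1 := ms _ m1; have n2 := ms _ m2; have n3 := ms _ m3; have n4 := ms _ m4.
have H : (2%:E * \int[m]_x (F x)%:E = 2%:E * (\int[m]_x (e1 x ^+ 2)%:E +
    \int[m]_x (e2 x ^+ 2)%:E + \int[m]_x (e3 x ^+ 2)%:E + \int[m]_x (e4 x ^+ 2)%:E))%E.
  rewrite [LHS]mule_natl mule2n -[X in (_ + X)%E]FF'.
  rewrite -[LHS]ge0_integralD//; last 4 first.
  - by move=> x _; rewrite lee_fin.
  - exact/measurable_EFinP.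
  - by move=> x _; rewrite lee_fin.
  - exact/measurable_EFinP.
  rewrite -ge0_integralD// -ge0_integralD//; last 2 first.
  - by move=> x _; rewrite adde_ge0.
  - exact: emeasurable_funD.
  rewrite -ge0_integralD//; last 2 first.
  - by move=> x _; rewrite !adde_ge0.
  - by apply: emeasurable_funD => //; exact: emeasurable_funD.
  rewrite -ge0_integralZl//; last 2 first.
  - by apply: emeasurable_funD => //; apply: emeasurable_funD => //; exact: emeasurable_funD.
  - by move=> x _; rewrite !adde_ge0.
  by apply: eq_integral => x _; rewrite -EFinD FE -!EFinD -EFinM.
have := congr1 (fun x => (2^-1%:E * x)%E) H.
by rewrite !muleA -!EFinM mulVf// !mul1e.
Qed.

Lemma integral_sum4 (f g1 g2 g3 g4 : T -> R) :
  m.-integrable setT (EFin \o g1) -> m.-integrable setT (EFin \o g2) ->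
  m.-integrable setT (EFin \o g3) -> m.-integrable setT (EFin \o g4) ->
  (forall x, f x = g1 x + g2 x + g3 x + g4 x) ->
  m.-integrable setT (EFin \o f) /\
  (\int[m]_x (g1 x)%:E + \int[m]_x (g2 x)%:E + \int[m]_x (g3 x)%:E +
    \int[m]_x (g4 x)%:E = \int[m]_x (f x)%:E)%E.
Proof.
move=> i1 i2 i3 i4 fE.
have j2 := integrableD measurableT i1 i2.
have j3 := integrableD measurableT j2 i3.
have j4 := integrableD measurableT j3 i4.
split; first by apply: eq_integrable j4 => // x _; rewrite /= fE.
rewrite -integralD// -integralD// -integralD//.
by apply: eq_integral => x _; rewrite fE.
Qed.

End four_terms.

Lemma mulr_sum2 (R : comRingType) (c d a b k1 k2 l1 l2 : R) :
  k1 + k2 = - (c * a) -> l1 + l2 = - (d * b) ->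
  c * d * (a * b) = k1 * l1 + k1 * l2 + k2 * l1 + k2 * l2.
Proof.
move=> k l; have -> : c * d * (a * b) = - (c * a) * - (d * b) by ring.
by rewrite -k -l; ring.
Qed.


Section distance_covariance_formula.
Context {R : realType} {n m : nat}.
Variable theta : probability (n.-tuple R * m.-tuple R)%type R.
Hypothesis hmu : finite_first_moment (marginal1 theta).
Hypothesis hnu : finite_first_moment (marginal2 theta).
Notation A := (n.-tuple R).
Notation B := (m.-tuple R).
Notation mu := (marginal1 theta).
Notation nu := (marginal2 theta).
Notation la := (@lebesgue_tuple R n).
Notation lb := (@lebesgue_tuple R m).

Let wa (t : A) : R := (euclid_norm t ^+ n.+1)^-1.
Let wb (s : B) : R := (euclid_norm s ^+ m.+1)^-1.

Let m1 b t : measurable_fun setT (fun q : A * B => trig b (euclid_dot t q.1)).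
Proof. exact: measurable_trig_dot. Qed.

Let m2 b s : measurable_fun setT (fun q : A * B => trig b (euclid_dot s q.2)).
Proof. exact: measurable_trig_dot. Qed.

Let mean1E b t : mean_trig mu b t = \int[theta]_q trig b (euclid_dot t q.1).
Proof.
rewrite /mean_trig /Rintegral integral_distribution//=.
  by apply/measurable_EFinP; exact: measurable_trig_dot.
by apply: integrable_bounded => // q; exact: norm_trig_le1.
Qed.

Let mean2E b s : mean_trig nu b s = \int[theta]_q trig b (euclid_dot s q.2).
Proof.
rewrite /mean_trig /Rintegral integral_distribution//=.
  by apply/measurable_EFinP; exact: measurable_trig_dot.
by apply: integrable_bounded => // q; exact: norm_trig_le1.
Qed.

Let moment b b' (p : A * B) : R :=
  \int[theta]_q (trig b (euclid_dot p.1 q.1) * trig b' (euclid_dot p.2 q.2)).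

(** The four covariances of the real and imaginary parts of exp (i <t, X>)
    and exp (i <s, Y>). *)
Definition trig_cov b b' (p : A * B) : R :=
  moment b b' p - mean_trig mu b p.1 * mean_trig nu b' p.2.

Let norm_trigM b b' x y : `|trig b x * trig b' y : R| <= 1.
Proof. by rewrite normrM mulr_ile1// norm_trig_le1. Qed.

Lemma measurable_trig_cov b b' : measurable_fun setT (trig_cov b b').
Proof.
apply: measurable_funB; last first.
  apply: measurable_funM.
    exact: (measurableT_comp (measurable_mean_trig mu b) measurable_fst).
  exact: (measurableT_comp (measurable_mean_trig nu b') measurable_snd).
apply: (@measurable_bounded_mean R _ _ theta _ _ (fun w : (A * B) * (A * B) =>
  trig b (euclid_dot w.1.1 w.2.1) * trig b' (euclid_dot w.1.2 w.2.2))).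
  apply: measurable_funM; apply: measurable_trig_dot.
  - exact: (measurableT_comp measurable_fst measurable_fst).
  - exact: (measurableT_comp measurable_fst measurable_snd).
  - exact: (measurableT_comp measurable_snd measurable_fst).
  - exact: (measurableT_comp measurable_snd measurable_snd).
by move=> w; exact: norm_trigM.
Qed.

Let iM b b' t s : theta.-integrable setT
  (fun q => (trig b (euclid_dot t q.1) * trig b' (euclid_dot s q.2))%:E).
Proof.
apply: integrable_bounded => [|q]; last exact: norm_trigM.
exact: measurable_funM.
Qed.

Let i1 b t : theta.-integrable setT (fun q => (trig b (euclid_dot t q.1))%:E).
Proof. by apply: integrable_bounded => // q; exact: norm_trig_le1. Qed.

Let i2 b s : theta.-integrable setT (fun q => (trig b (euclid_dot s q.2))%:E).
Proof. by apply: integrable_bounded => // q; exact: norm_trig_le1. Qed.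

Lemma mean_wtrigM b b' t s :
  \int[theta]_q (wtrig mu b (t, q.1) * wtrig nu b' (s, q.2)) =
  Num.sqrt (wa t) * Num.sqrt (wb s) * trig_cov b b' (t, s).
Proof.
set r := Num.sqrt (wa t) * Num.sqrt (wb s).
set c := mean_trig mu b t; set d := mean_trig nu b' s.
have j1 := integrableZl measurableT d (i1 b t).
have j2 := integrableZl measurableT c (i2 b' s).
have j3 := finite_measure_integrable_cst theta (c * d) measurableT.
have j4 := integrableB measurableT (iM b b' t s) j1.
have j5 := integrableB measurableT j4 j2.
have j6 := integrableD measurableT j5 j3.
have -> : \int[theta]_q (wtrig mu b (t, q.1) * wtrig nu b' (s, q.2)) =
  \int[theta]_q (r * (trig b (euclid_dot t q.1) * trig b' (euclid_dot s q.2) -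
     d * trig b (euclid_dot t q.1) - c * trig b' (euclid_dot s q.2) + c * d)).
  by apply: eq_Rintegral => q _; rewrite /wtrig/= -/c -/d /r; ring.
rewrite RintegralZl//; congr (_ * _).
rewrite RintegralD// RintegralB// RintegralB//; last exact: iM.
rewrite RintegralZl//; last exact: i1.
rewrite RintegralZl//; last exact: i2.
rewrite Rintegral_cst//= probability_setT/= mulr1 -mean1E -mean2E -/c -/d.
by rewrite /trig_cov/moment/= -/c -/d; ring.
Qed.

(** Replacing s by - s changes the sign of the sine of <s, Y>; this is what
    removes the cross terms in [normc_charfun_sqr]. *)
Lemma trig_cov_opp b b' t s :
  trig_cov b b' (t, tuple_opp s) = (-1) ^+ (~~ b') * trig_cov b b' (t, s).
Proof.
rewrite /trig_cov /moment/= mulrBr; congr (_ - _).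
  rewrite -RintegralZl//; last exact: iM.
  by apply: eq_Rintegral => q _; rewrite euclid_dot_oppl trig_opp mulrCA.
rewrite [RHS]mulrCA; congr (_ * _).
rewrite !mean2E -RintegralZl//; last exact: i2.
by apply: eq_Rintegral => q _; rewrite euclid_dot_oppl trig_opp.
Qed.

(** The difference of characteristic functions is the covariance of the two
    complex exponentials, expanded into real and imaginary parts. *)
Lemma normc_charfun_sqr t s :
  Normc.normc (charfun2 theta t s - charfun mu t * charfun nu s) ^+ 2 =
  (trig_cov true true (t, s) - trig_cov false false (t, s)) ^+ 2 +
  (trig_cov true false (t, s) + trig_cov false true (t, s)) ^+ 2.
Proof.
have Er : \int[theta]_q cos (euclid_dot t q.1 + euclid_dot s q.2) =
    moment true true (t, s) - moment false false (t, s).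
  rewrite -RintegralB//; try exact: iM.
  by apply: eq_Rintegral => q _; rewrite cosD.
have Ei : \int[theta]_q sin (euclid_dot t q.1 + euclid_dot s q.2) =
    moment true false (t, s) + moment false true (t, s).
  rewrite -RintegralD//; try exact: iM.
  by apply: eq_Rintegral => q _; rewrite sinD addrC.
rewrite /charfun2 /charfun /Cintegral/= Er Ei sqr_sqrtr ?addr_ge0 ?sqr_ge0//.
(* both characteristic functions have the means of cosine and sine as parts *)
rewrite -/(mean_trig mu true t) -/(mean_trig mu false t).
rewrite -/(mean_trig nu true s) -/(mean_trig nu false s) /trig_cov/=.
by congr (_ ^+ 2 + _ ^+ 2); ring.
Qed.

Let F (p : A * B) : R := Normc.normc (charfun2 theta p.1 p.2 -
    charfun mu p.1 * charfun nu p.2) ^+ 2 /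
  (euclid_norm p.1 ^+ n.+1 * euclid_norm p.2 ^+ m.+1).

Let E b b' (p : A * B) : R :=
  \int[theta]_q (wtrig mu b (p.1, q.1) * wtrig nu b' (p.2, q.2)).

(** The cross terms of the two squares in [normc_charfun_sqr] are odd in s,
    so they cancel in the sum. *)
Let F_opp t s : F (t, s) + F (t, tuple_opp s) = 2 * (E true true (t, s) ^+ 2 +
  E true false (t, s) ^+ 2 + E false true (t, s) ^+ 2 + E false false (t, s) ^+ 2).
Proof.
rewrite /F/= !normc_charfun_sqr !trig_cov_opp /E/= !mean_wtrigM euclid_norm_opp invfM.
rewrite -/(wa t) -/(wb s) !expr0 !expr1 !mul1r !mulN1r.
have wa0 : 0 <= wa t by rewrite invr_ge0 exprn_ge0// euclid_norm_ge0.
have wb0 : 0 <= wb s by rewrite invr_ge0 exprn_ge0// euclid_norm_ge0.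
have : Num.sqrt (wa t) ^+ 2 = wa t by rewrite sqr_sqrtr.
have : Num.sqrt (wb s) ^+ 2 = wb s by rewrite sqr_sqrtr.
move: (Num.sqrt (wa t)) (Num.sqrt (wb s)) => x y <- <-; ring.
Qed.

Let F0 p : 0 <= F p.
Proof.
by rewrite divr_ge0 ?sqr_ge0// mulr_ge0// exprn_ge0// euclid_norm_ge0.
Qed.

Let mF : measurable_fun setT F.
Proof.
apply: measurable_funM.
  rewrite (_ : (fun x => _) = (fun p =>
    (trig_cov true true p - trig_cov false false p) ^+ 2 +
    (trig_cov true false p + trig_cov false true p) ^+ 2)).
    apply: measurable_funD; apply: measurable_funX.
      by apply: measurable_funB; exact: measurable_trig_cov.
    by apply: measurable_funD; exact: measurable_trig_cov.
  by apply/funext => -[t s]; exact: normc_charfun_sqr.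
apply: (measurableT_comp measurable_invr); apply: measurable_funM.
  by apply: measurable_funX; apply: measurable_euclid_norm; exact: measurable_fst.
by apply: measurable_funX; apply: measurable_euclid_norm; exact: measurable_snd.
Qed.

Let mE b b' : measurable_fun setT (E b b').
Proof.
have -> : E b b' = fun p =>
    Num.sqrt (wa p.1) * Num.sqrt (wb p.2) * trig_cov b b' p.
  by apply/funext => -[t s]; rewrite /E mean_wtrigM.
have ms := continuous_measurable_fun (@sqrt_continuous R).
apply: measurable_funM; last exact: measurable_trig_cov.
apply: measurable_funM; apply: (measurableT_comp ms).
  by apply: measurable_expVn; apply: measurable_euclid_norm; exact: measurable_fst.
by apply: measurable_expVn; apply: measurable_euclid_norm; exact: measurable_snd.
Qed.

Let mo : measurable_fun setT (fun p : A * B => (p.1, tuple_opp p.2)).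
Proof.
apply: measurable_fun_pair; first exact: measurable_fst.
exact: (measurableT_comp (@measurable_tuple_opp R m) measurable_snd).
Qed.

Let int_F_opp : (\int[la \x lb]_p (F (p.1, tuple_opp p.2))%:E =
  \int[la \x lb]_p (F p)%:E)%E.
Proof.
rewrite fubini_tonelli1; last 2 first.
- by apply/measurable_EFinP; exact: (measurableT_comp mF mo).
- by move=> p; rewrite lee_fin.
rewrite [RHS]fubini_tonelli1; last 2 first.
- exact/measurable_EFinP.
- by move=> p; rewrite lee_fin.
apply: eq_integral => t _; rewrite /fubini_F/=.
rewrite (ge0_integral_tuple_opp (f := fun s => (F (t, s))%:E))//.
- by apply/measurable_EFinP; apply: (measurableT_comp mF); exact: measurable_fun_pair.
- by move=> s; rewrite lee_fin.
Qed.

Let int_F : (\int[la \x lb]_p (F p)%:E =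
  \int[la \x lb]_p (E true true p ^+ 2)%:E + \int[la \x lb]_p (E true false p ^+ 2)%:E +
  \int[la \x lb]_p (E false true p ^+ 2)%:E + \int[la \x lb]_p (E false false p ^+ 2)%:E)%E.
Proof.
apply: (integral_half_sum_sqr mF _ (mE true true) (mE true false) (mE false true)
  (mE false false) F0 _ int_F_opp) => [|p|[t s]].
- exact: (measurableT_comp mF mo).
- exact: F0.
- exact: F_opp.
Qed.

Let Ka b x x' : R := \int[la]_t (wtrig mu b (t, x) * wtrig mu b (t, x')).
Let Kb b y y' : R := \int[lb]_s (wtrig nu b (s, y) * wtrig nu b (s, y')).

Let hyps b b' :
  [/\ forall x, (\int[la]_t (wtrig mu b (t, x) ^+ 2)%:E < +oo)%E,
      forall y, (\int[lb]_s (wtrig nu b' (s, y) ^+ 2)%:E < +oo)%E,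
      (\int[theta]_p \int[la]_t (wtrig mu b (t, p.1) ^+ 2)%:E < +oo)%E,
      (\int[theta]_p \int[lb]_s (wtrig nu b' (s, p.2) ^+ 2)%:E < +oo)%E &
      forall t s, theta.-integrable setT
        (fun p => (wtrig mu b (t, p.1) * wtrig nu b' (s, p.2))%:E)].
Proof.
have pos k (S : k.-tuple R * k.-tuple R -> R) (y : k.-tuple R) :
    (0 <= \int[@lebesgue_tuple R k]_t (S (t, y) ^+ 2)%:E)%E.
  by apply: integral_ge0 => t _; rewrite lee_fin sqr_ge0.
split.
- by move=> x; exact: le_lt_trans (integral_sqr_wtrig_le hmu b x) (ltry _).
- by move=> y; exact: le_lt_trans (integral_sqr_wtrig_le hnu b' y) (ltry _).
- have := mean_integral_sqr_wtrig_lty hmu b.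
  rewrite ge0_integral_distribution//.
  exact: measurable_integral_sqr_wtrig.
- have := mean_integral_sqr_wtrig_lty hnu b'.
  rewrite ge0_integral_distribution//.
  exact: measurable_integral_sqr_wtrig.
move=> t s.
set c := mean_trig mu b t; set d := mean_trig nu b' s.
have -> : (fun p => (wtrig mu b (t, p.1) * wtrig nu b' (s, p.2))%:E) = (fun q =>
   (Num.sqrt (wa t) * Num.sqrt (wb s) *
   (trig b (euclid_dot t q.1) * trig b' (euclid_dot s q.2) -
     d * trig b (euclid_dot t q.1) - c * trig b' (euclid_dot s q.2) + c * d))%:E).
  by apply/funext => q; congr EFin; rewrite /wtrig/= -/c -/d; ring.
have j1 := integrableZl measurableT d (i1 b t).
have j2 := integrableZl measurableT c (i2 b' s).
have j3 := finite_measure_integrable_cst theta (c * d) measurableT.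
have j4 := integrableB measurableT (iM b b' t s) j1.
have j5 := integrableB measurableT j4 j2.
have j6 := integrableD measurableT j5 j3.
exact: (integrableZl measurableT _ j6).
Qed.

Let EK b b' : (\int[la \x lb]_p (E b b' p ^+ 2)%:E =
  \int[theta \x theta]_q (Ka b q.1.1 q.2.1 * Kb b' q.1.2 q.2.2)%:E)%E.
Proof.
have [h1 h2 h3 h4 h5] := hyps b b'.
exact: (integral_sqr_mean (measurable_wtrig mu b) (measurable_wtrig nu b') h1 h2 h3 h4 h5).
Qed.

Let iK b b' : (theta \x theta)%E.-integrable setT
  (fun q => (Ka b q.1.1 q.2.1 * Kb b' q.1.2 q.2.2)%:E).
Proof.
have [h1 h2 h3 h4 _] := hyps b b'.
exact: (integrable_kernel_prod (measurable_wtrig mu b) (measurable_wtrig nu b') h1 h2 h3 h4).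
Qed.

Let dd (q : (A * B) * (A * B)) : R :=
  centered_dist euclid_dist mu q.1.1 q.2.1 * centered_dist euclid_dist nu q.1.2 q.2.2.

(** By symmetrisation the integral is the sum of four integrals of squared
    means; [integral_sqr_mean] rewrites each as the mean of a product of kernels,
    and the sum over the four pairs of kernels factorises by [kernel_sum], the two
    signs cancelling. *)
Lemma integral_charfun_dist :
  (theta \x theta)%E.-integrable setT (fun q => (cst_c n * cst_c m * dd q)%:E) /\
  (\int[la \x lb]_p (F p)%:E =
   \int[theta \x theta]_q (cst_c n * cst_c m * dd q)%:E)%E.
Proof.
have [] := integral_sum4 (iK true true) (iK true false) (iK false true) (iK false false)
  (f := fun q => cst_c n * cst_c m * dd q).
  move=> q; apply: mulr_sum2; [exact: (kernel_sum hmu)|exact: (kernel_sum hnu)].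
move=> idd sumE; split; first exact: idd.
apply: (etrans int_F); apply: etrans sumE.
by congr (_ + _ + _ + _)%E; exact: EK.
Qed.

End distance_covariance_formula.

(** * Dimension zero *)

Section dimension_zero.
Context {R : realType}.

Lemma euclid_norm_tuple0 (x : 0.-tuple R) : euclid_norm x = 0.
Proof. by rewrite /euclid_norm /euclid_dot big_ord0 sqrtr0. Qed.

Lemma centered_dist_tuple0 (rho : probability (0.-tuple R) R) x y :
  centered_dist euclid_dist rho x y = 0.
Proof.
have d0 (u v : 0.-tuple R) : euclid_dist u v = 0 by exact: euclid_norm_tuple0.
have a0 u : mean_dist euclid_dist rho u = 0.
  by rewrite /mean_dist /Rintegral integral0_eq// => v _; rewrite d0.
rewrite /centered_dist d0 !a0 /total_mean_dist /Rintegral integral0_eq ?subr0 ?addr0//.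
by move=> v _; rewrite a0.
Qed.

End dimension_zero.

Theorem theorem4p5 (R : realType) (n m : nat)
    (theta : probability (n.-tuple R * m.-tuple R)%type R)
    (hmu : finite_first_moment (marginal1 theta))
    (hnu : finite_first_moment (marginal2 theta)) :
  (Num.sqrt (dcov euclid_dist euclid_dist theta))%:E =
  sqrte (((cst_c n * cst_c m)^-1)%:E *
    \int[lebesgue_tuple n \x lebesgue_tuple m]_p
      (Normc.normc (charfun2 theta p.1 p.2 -
                    charfun (marginal1 theta) p.1 *
                    charfun (marginal2 theta) p.2) ^+ 2 /
       (euclid_norm p.1 ^+ n.+1 * euclid_norm p.2 ^+ m.+1))%:E)%E.
Proof.
case: n theta hmu hnu => [|n'] th hmu' hnu'.
  rewrite /dcov /Rintegral integral0_eq/=; last first.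
    by move=> q _; rewrite centered_dist_tuple0 mul0r.
  rewrite integral0_eq ?mule0 ?sqrte0 ?sqrtr0// => p _.
  by rewrite euclid_norm_tuple0 expr0n/= mul0r invr0 mulr0.
case: m th hmu' hnu' => [|m'] th hmu' hnu'.
  rewrite /dcov /Rintegral integral0_eq/=; last first.
    by move=> q _; rewrite [X in _ * X]centered_dist_tuple0 mulr0.
  rewrite integral0_eq ?mule0 ?sqrte0 ?sqrtr0// => p _.
  by rewrite [euclid_norm p.2]euclid_norm_tuple0 [0 ^+ 1]expr0n/= mulr0 invr0 mulr0.
have [ic ->] := integral_charfun_dist hmu' hnu'.
set c := cst_c n'.+1 * cst_c m'.+1 in ic *.
have c0 : c != 0 by rewrite mulf_neq0// gt_eqF// cst_c_gt0.
have id := integrableZl measurableT c^-1 ic.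
have {}id : (th \x th)%E.-integrable setT (fun q =>
    (centered_dist euclid_dist (marginal1 th) q.1.1 q.2.1 *
     centered_dist euclid_dist (marginal2 th) q.1.2 q.2.2)%:E).
  by apply: eq_integrable id => // q _; rewrite -EFinM mulKf.
under eq_integral do rewrite EFinM.
rewrite integralZl// muleA -EFinM mulVf// mul1e.
by rewrite -(fineK (integrable_fin_num _ id)).
Qed.
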